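(* Let $\mathcal{X},\mathcal{Y}\subset\mathbb{R}^d$ be compact with $\mathcal{X}$ convex, let $\mu$ and $\nu$ be Borel probability measures with supports $\mathcal{X}$ and $\mathcal{Y}$ respectively, let $\lambda>0$, and let $c(x,y)=-\langle x,y\rangle$. Suppose that $\mu$ admits a density $f$ on $\mathcal{X}$ satisfying $0<m\le f\le M<\infty$ for some positive constants $m$ and $M$. Then the dual sub-optimality gap $\delta_t$ of Sinkhorn's iterates satisfies: 1. For any integer $t\ge0$, $\delta_t\le\delta_0(1-\alpha^{-1})^t$, where $\alpha=176\Big(1+\frac{M}{m}\frac{c_\infty}{\lambda}+\frac{c_\infty^2}{\lambda^2}\Big)$. 2. For any large enough $t$, $\delta_{t+1}\le\delta_t(1-\alpha^{-1})$, where $\alpha=176\Big(1+\frac{M}{m}\frac{c_\infty}{\lambda}\Big)$.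
   Context: Densities are with respect to Lebesgue measure on $\mathbb{R}^d$. $c_\infty=\sup_{\mathcal{X}\times\mathcal{Y}}c-\inf_{\mathcal{X}\times\mathcal{Y}}c$. For $\phi\in L^\infty(\mu)$ and $\psi\in L^\infty(\nu)$, the $(c,\lambda)$-transforms are $$\phi^{c,\lambda}(y)=-\lambda\log\int \exp\Big(\frac{\phi(x)-c(x,y)}{\lambda}\Big)d\mu(x),\qquad \psi^{c,\lambda}(x)=-\lambda\log\int \exp\Big(\frac{\psi(y)-c(x,y)}{\lambda}\Big)d\nu(y).$$ The dual functional is $$F(\phi,\psi)=\int\phi\,d\mu+\int\psi\,d\nu+\lambda\Big(1-\iint \exp\Big(\frac{\phi(x)+\psi(y)-c(x,y)}{\lambda}\Big)d\mu(x)d\nu(y)\Big).$$ Sinkhorn's iterates start from an arbitrary $\psi_0\in L^\infty(\nu)$ and are defined by $\phi_{t+1/2}=\psi_t^{c,\lambda}$, $\psi_{t+1}=\phi_{t+1/2}^{c,\lambda}$ for integers $t\ge0$. The dual sub-optimality gap is $$\delta_t=\sup_{\phi\in L^\infty(\mu),\,\psi\in L^\infty(\nu)}F(\phi,\psi)-F(\phi_{t+1/2},\psi_t).$$ *)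

(* Defs.v *)
From HB Require Import structures.
From mathcomp Require Import all_boot all_order all_algebra.
From mathcomp Require Import all_classical all_reals all_analysis.

Set Implicit Arguments.
Unset Strict Implicit.
Unset Printing Implicit Defensive.

Import Order.TTheory GRing.Theory Num.Theory.
Import numFieldNormedType.Exports.

Local Open Scope classical_set_scope.
Local Open Scope ring_scope.

(* Matrices, in particular R^n = 'rV[R]_n, carry their Borel sigma-algebra. *)
HB.instance Definition _ (R : realType) (m n : nat) :=
  isMeasurable.Build (sigma_display (@open 'M[R]_(m, n))) 'M[R]_(m, n)
    (@sigma_algebra0 _ setT (@open 'M[R]_(m, n)))
    (@sigma_algebraC _ (@open 'M[R]_(m, n)))
    (@sigma_algebra_bigcup _ setT (@open 'M[R]_(m, n))).

Section borel_rV.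
Context {R : realType}.

Lemma open_measurable_rV n (U : set 'rV[R]_n) : open U -> measurable U.
Proof. exact: sub_sigma_algebra. Qed.

Lemma measurable_coord_rV n (j : 'I_n) :
  measurable_fun [set: 'rV[R]_n] (fun v : 'rV[R]_n => v 0 j).
Proof.
apply: (measurability _ (measurable_realfun.RGenOpens.measurableE R)).
move=> _ [_ [a [b ->]] <-]; rewrite setTI; apply: open_measurable_rV.
have /continuousP := @coord_continuous R 1 n 0 j; apply.
exact: interval_open.
Qed.

(* Cubes with rational centre and radius form a countable basis. *)
Let cube n (p : 'rV[rat]_n * rat) : set 'rV[R]_n :=
  [set v | forall j, `|v 0 j - ratr (p.1 0 j)| < ratr p.2].

Let open_rVE n (U : set 'rV[R]_n) : open U ->
  U = \bigcup_p (if `[< cube p `<=` U >] then cube p else set0).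
Proof.
move=> oU; apply/seteqP; split=> [v Uv|v [p _]]; last first.
  by case: asboolP => // pU /pU.
have /nbhs_ballP[e /= e0 eU] : nbhs v U by exact: open_nbhs_nbhs.
have [r] := rat_in_itvoo (divr_gt0 e0 (ltr0n R 2) : 0 < e / 2).
rewrite in_itv/= => /andP[r0 re].
have /choice[q hq] : forall j : 'I_n, exists q : rat,
    `|v 0 j - ratr q| < ratr r.
  move=> j; have : v 0 j - ratr r < v 0 j + ratr r.
    by rewrite ltrD2l gtrN.
  by move=> /rat_in_itvoo[q]; rewrite in_itv/= -ltr_distl distrC; exists q.
exists (\row_j q j, r) => //; case: asboolP => [_|[]].
  by move=> j /=; rewrite mxE.
move=> w hw; apply: eU; split => // i j; rewrite (ord1 i) /ball/=.
have := hw j; rewrite /= mxE distrC => wj.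
rewrite (splitr e) -(subrKA (ratr (q j))).
by rewrite (le_lt_trans (ler_normD _ _))// ltrD// (lt_trans _ re).
Qed.

Lemma measurable_fun_rVP d (T : measurableType d) n (f : T -> 'rV[R]_n) :
  measurable_fun setT f <-> forall j, measurable_fun setT (fun x => f x 0 j).
Proof.
split=> [mf j|mf].
  exact: (measurableT_comp (measurable_coord_rV j) mf).
apply: (@measurability _ _ _ _ _ _ (@open 'rV[R]_n)) => // _ [U oU <-].
rewrite setTI (open_rVE oU) preimage_bigcup.
apply: countable_bigcupT_measurable => // p.
case: asboolP => _; last by rewrite preimage_set0.
pose I j : set R := `](ratr (p.1 0 j) - ratr p.2), (ratr (p.1 0 j) + ratr p.2)[%classic.
rewrite (_ : _ @^-1` _ =
    \bigcap_(j in [set: 'I_n]) ((fun x => f x 0 j) @^-1` I j)).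
  apply: fin_bigcap_measurable => // j _.
  by rewrite -[X in measurable X]setTI; apply: mf => //; exact: measurable_itv.
by apply/seteqP; split=> x /= h j => [_|]; have := h j;
  rewrite /I /= in_itv/= -ltr_distl => //; exact.
Qed.

End borel_rV.

Section lebesgue_rV.
Context {R : realType}.

Definition cons_rV n (p : R * 'rV[R]_n) : 'rV[R]_n.+1 :=
  \row_j oapp (p.2 0) p.1 (unlift 0 j).

Definition uncons_rV n (v : 'rV[R]_n.+1) : R * 'rV[R]_n :=
  (v 0 0, \row_j v 0 (lift 0 j)).

Lemma cons_rV0 n (p : R * 'rV[R]_n) : cons_rV p 0 0 = p.1.
Proof. by rewrite mxE unlift_none. Qed.

Lemma cons_rVS n (p : R * 'rV[R]_n) j : cons_rV p 0 (lift 0 j) = p.2 0 j.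
Proof. by rewrite mxE liftK. Qed.

Lemma cons_rVK n : cancel (@cons_rV n) (@uncons_rV n).
Proof.
move=> [x v]; rewrite /uncons_rV cons_rV0; congr pair.
by apply/rowP => j; rewrite mxE cons_rVS.
Qed.

Lemma measurable_cons_rV n : measurable_fun setT (@cons_rV n).
Proof.
apply/measurable_fun_rVP => j; case: (unliftP 0 j) => [k|] ->.
  under eq_fun do rewrite cons_rVS.
  exact: (measurableT_comp (measurable_coord_rV k)).
by under eq_fun do rewrite cons_rV0; exact: measurable_fst.
Qed.

Lemma measurable_uncons_rV n : measurable_fun setT (@uncons_rV n).
Proof.
apply/measurable_fun_pairP; split; first exact: measurable_coord_rV.
apply/measurable_fun_rVP => j /=; under eq_fun do rewrite mxE.
exact: measurable_coord_rV.
Qed.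

Definition lebesgue_rV_step n (m : {sigma_finite_measure set 'rV[R]_n -> \bar R})
    : set 'rV[R]_n.+1 -> \bar R :=
  pushforward (lebesgue_measure \x m)%E (@cons_rV n).

Section step.
Variables (n : nat) (m : {sigma_finite_measure set 'rV[R]_n -> \bar R}).

HB.instance Definition _ := Measure.copy (lebesgue_rV_step m)
  (measure_function_pushforward__canonical__measure_function_Measure
    (lebesgue_measure \x m)%E (@measurable_cons_rV n)).

Let step_sigma_finite : sigma_finite setT (lebesgue_rV_step m).
Proof.
have /sigma_finiteP[F [FT ndF Foo]] := sigma_finiteT (@lebesgue_measure R).
have /sigma_finiteP[G [GT ndG Goo]] := sigma_finiteT m.
exists (fun k => @uncons_rV n @^-1` (F k `*` G k)).
  rewrite -preimage_bigcup (_ : \bigcup_k _ = setT) ?preimage_setT//.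
  apply/seteqP; split=> // -[x v] _.
  have [k _ Fx] : (\bigcup_k F k) x by rewrite -FT.
  have [l _ Gv] : (\bigcup_k G k) v by rewrite -GT.
  exists (maxn k l) => //; split => /=.
  - by move: x Fx; exact/subsetPset/ndF/leq_maxl.
  - by move: v Gv; exact/subsetPset/ndG/leq_maxr.
move=> k; have [mF Fk] := Foo k; have [mG Gk] := Goo k; split.
  rewrite -[X in measurable X]setTI; apply: measurable_uncons_rV => //.
  exact: measurableX.
rewrite /lebesgue_rV_step /pushforward -comp_preimage.
rewrite (_ : _ \o _ = id) ?preimage_id; last exact/funext/cons_rVK.
by rewrite product_measure1E// lte_mul_pinfty// ge0_fin_numE.
Qed.

HB.instance Definition _ := Measure_isSigmaFinite.Build _ _ _
  (lebesgue_rV_step m) step_sigma_finite.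
End step.

(* Lebesgue measure on the Borel sets of R^n, as the iterated product of
   [lebesgue_measure], transported from R * R^n to R^n.+1; [lebesgue_rV_prod]
   gives its values on boxes. *)
Fixpoint lebesgue_rV n : {sigma_finite_measure set 'rV[R]_n -> \bar R} :=
  if n is k.+1 then lebesgue_rV_step (lebesgue_rV k) else dirac (0 : 'rV[R]_0).

Lemma lebesgue_rV_prod n (A : 'I_n -> set R) : (forall j, measurable (A j)) ->
  lebesgue_rV n [set v | forall j, A j (v 0 j)] =
  (\prod_(j < n) lebesgue_measure (A j))%E.
Proof.
elim: n A => [|n IH] A mA.
  by rewrite big_ord0 /= diracE mem_set// => -[].
rewrite big_ord_recl -IH; last by move=> j; exact: mA.
rewrite [LHS](_ : _ = (lebesgue_measure \x lebesgue_rV n)%E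
  (A 0 `*` [set v : 'rV[R]_n | forall j, A (lift 0 j) (v 0 j)])); last first.
  rewrite /= /lebesgue_rV_step /pushforward; congr (_ _); apply/seteqP; split.
    move=> p /= h; split; first by rewrite -cons_rV0.
    by move=> j; rewrite -cons_rVS.
  move=> p /= [h0 hS] j; case: (unliftP 0 j) => [k|] ->.
    by rewrite cons_rVS.
  by rewrite cons_rV0.
apply: product_measure1E; first exact: mA.
have -> : [set v : 'rV[R]_n | forall j, A (lift 0 j) (v 0 j)] =
    \bigcap_(j in [set: 'I_n])
      ((fun v : 'rV[R]_n => v 0 j) @^-1` A (lift 0 j)).
  by apply/seteqP; split=> v /= h j => [_|]; [exact: h|exact: (h j)].
apply: fin_bigcap_measurable => // j _; rewrite -[X in measurable X]setTI.
exact: measurable_coord_rV.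
Qed.

End lebesgue_rV.

Definition msupport {R : realType} {n : nat}
    (mu : {measure set 'rV[R]_n -> \bar R}) : set 'rV[R]_n :=
  [set x | forall U : set 'rV[R]_n, open U -> U x -> (0 < mu U)%E].

(* [f] is a density of [mu] w.r.t. Lebesgue measure, where [mu] is carried by
   [X]; the values of [f] outside [X] are irrelevant. *)
Definition is_density_on {R : realType} {n : nat}
    (mu : {measure set 'rV[R]_n -> \bar R}) (X : set 'rV[R]_n)
    (f : 'rV[R]_n -> R) : Prop :=
  measurable_fun X f /\
  forall A, measurable A ->
    mu A = (\int[lebesgue_rV n]_(x in A `&` X) (f x)%:E)%E.

Definition dotrV {R : realType} {n : nat} (x y : 'rV[R]_n) : R :=
  \sum_(i < n) x 0 i * y 0 i.

Definition oscillation {R : realType} {T1 T2 : Type} (X : set T1) (Y : set T2)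
    (c : T1 -> T2 -> R) : R :=
  sup [set c p.1 p.2 | p in X `*` Y] - inf [set c p.1 p.2 | p in X `*` Y].

Section sinkhorn.
Context {R : realType} {d1 d2} {T1 : measurableType d1} {T2 : measurableType d2}.
Variables (mu : probability T1 R) (nu : probability T2 R).
Variables (c : T1 -> T2 -> R) (lambda : R).

(* The (c, lambda)-transforms of functions on T1 and on T2, respectively. *)
Definition transform_l (phi : T1 -> R) : T2 -> R := fun y =>
  - lambda * ln (\int[mu]_x expR ((phi x - c x y) / lambda)).

Definition transform_r (psi : T2 -> R) : T1 -> R := fun x =>
  - lambda * ln (\int[nu]_y expR ((psi y - c x y) / lambda)).

Definition dual (phi : T1 -> R) (psi : T2 -> R) : R :=
  \int[mu]_x phi x + \int[nu]_y psi y +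
  lambda * (1 - \int[(mu \x nu)%E]_p
                  expR ((phi p.1 + psi p.2 - c p.1 p.2) / lambda)).

(* [sinkhorn_psi psi0 t] is psi_t, [sinkhorn_phi psi0 t] is phi_(t + 1/2). *)
Fixpoint sinkhorn_psi (psi0 : T2 -> R) (t : nat) : T2 -> R :=
  if t is s.+1 then transform_l (transform_r (sinkhorn_psi psi0 s)) else psi0.

Definition sinkhorn_phi (psi0 : T2 -> R) (t : nat) : T1 -> R :=
  transform_r (sinkhorn_psi psi0 t).

(* Elements of L^oo are represented by measurable functions; [dual] does not
   depend on the representatives. For bounded [c] the set is bounded above. *)
Definition dual_sup : R :=
  sup [set dual p.1 p.2 | p in
    [set p : (T1 -> R) * (T2 -> R) |
      p.1 \in Lfun mu +oo%E /\ p.2 \in Lfun nu +oo%E]].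

Definition dual_gap (psi0 : T2 -> R) (t : nat) : R :=
  dual_sup - dual (sinkhorn_phi psi0 t) (sinkhorn_psi psi0 t).

End sinkhorn.

(* Main.v *)
(* The semi-dual functional E(psi) = F(psi^c, psi) increases along psi' = sink psi =
   (psi^c)^c by at least gain(psi), the integral of psi' - psi against nu, which is
   lambda times the relative entropy of nu with respect to the second marginal of
   the Gibbs coupling of (psi^c, psi). Moreover gain(sink psi) <= gain(psi). It
   therefore suffices to bound the gap sup E - E(psi) by
   (32 + 176 (M/m) c_oo / lambda) gain(psi) for psi of oscillation at most c_oo, a
   property of every iterate but the first.

   Compare psi with a nearly optimal psi1, and put phi = psi^c, phi1 = psi1^c. The
   gap is, up to a nonpositive term (Gibbs' inequality), the integral of
   psi1 - psi + k against the defect of the second marginal, where k centres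
   psi1 - psi; by Donsker-Varadhan duality it is at most a multiple of gain(psi)
   plus a small multiple of the integral of (psi1 - psi + k)^2. This square is at
   most 2 (phi1 - phi + psi1 - psi)^2 + 2 (phi1 - phi - k)^2. The first term is
   controlled by a relative entropy between Gibbs couplings, hence by the gap. The
   second is the variance of phi1 - phi under mu. Since c is affine in x, the
   midpoint inequality (phi(x) + phi1(x')) / 2 <= ((psi + psi1) / 2)^c((x + x') / 2)
   holds on the convex set X, and the Prekopa-Leindler inequality applied to small
   multiples of these functions bounds the variance by 38 (M/m) c_oo times the
   concavity defect of E at the midpoint of psi and psi1, hence by the gap again. *)
Require Import Defs.
From mathcomp Require Import all_boot all_order all_algebra.
From mathcomp Require Import all_classical all_reals all_analysis.
From mathcomp Require Import measurable_realfun ess_sup_inf.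
From mathcomp Require Import ring lra.
Set Implicit Arguments.
Unset Strict Implicit.
Unset Printing Implicit Defensive.

Import Order.TTheory GRing.Theory Num.Theory.
Import numFieldNormedType.Exports.
Local Open Scope classical_set_scope.
Local Open Scope ring_scope.

(** * Bounded measurable functions and their integrals *)

(** Bounded everywhere rather than essentially: such functions are integrable for every probability
    and every product of two, and Fubini applies to them without side conditions. Elements of L^oo
    are clipped to this class later. *)
Definition bmeas {R : realType} {d} {T : measurableType d} (f : T -> R) : Prop :=
  measurable_fun setT f /\ exists B, forall x, `|f x| <= B.

Section bmeas_theory.
Context {R : realType} {d} {T : measurableType d}.
Implicit Types f g : T -> R.

Lemma bmeas_cst (k : R) : bmeas (fun _ : T => k).
Proof. by split; [exact: measurable_cst | exists `|k|]. Qed.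

Lemma bmeasD f g : bmeas f -> bmeas g -> bmeas (fun x => f x + g x).
Proof.
move=> [mf [B fB]] [mg [C gC]]; split; first exact: measurable_funD.
by exists (B + C) => x; rewrite (le_trans (ler_normD _ _))// lerD.
Qed.

Lemma bmeasN f : bmeas f -> bmeas (fun x => - f x).
Proof.
move=> [mf [B fB]]; split; first exact: measurableT_comp.
by exists B => x; rewrite normrN.
Qed.

Lemma bmeasB f g : bmeas f -> bmeas g -> bmeas (fun x => f x - g x).
Proof. by move=> bf bg; apply: bmeasD => //; exact: bmeasN. Qed.

Lemma bmeasM f g : bmeas f -> bmeas g -> bmeas (fun x => f x * g x).
Proof.
move=> [mf [B fB]] [mg [C gC]]; split; first exact: measurable_funM.
by exists (B * C) => x; rewrite normrM ler_pM.
Qed.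

Lemma bmeasX f n : bmeas f -> bmeas (fun x => f x ^+ n).
Proof.
move=> bf; elim: n => [|n IH].
  by under eq_fun do rewrite expr0; exact: bmeas_cst.
by under eq_fun do rewrite exprS; exact: bmeasM.
Qed.

Lemma bmeas_expR f : bmeas f -> bmeas (fun x => expR (f x)).
Proof.
move=> [mf [B fB]]; split; first exact: measurableT_comp.
exists (expR B) => x; rewrite ger0_norm ?expR_ge0// ler_expR.
exact: le_trans (ler_norm _) (fB x).
Qed.

Lemma bmeas_comp d' (T' : measurableType d') (h : T' -> T) f :
  measurable_fun setT h -> bmeas f -> bmeas (fun x => f (h x)).
Proof.
move=> mh [mf [B fB]]; split; first exact: measurableT_comp.
by exists B.
Qed.

End bmeas_theory.

Section bmeas_prod.
Context {R : realType} {d1 d2} {T1 : measurableType d1} {T2 : measurableType d2}.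

Lemma bmeas_fst (f : T1 -> R) : bmeas f -> bmeas (fun p : T1 * T2 => f p.1).
Proof. by apply: bmeas_comp; exact: measurable_fst. Qed.

Lemma bmeas_snd (f : T2 -> R) : bmeas f -> bmeas (fun p : T1 * T2 => f p.2).
Proof. by apply: bmeas_comp; exact: measurable_snd. Qed.

Lemma bmeas_pair1 (f : T1 * T2 -> R) x : bmeas f -> bmeas (fun y => f (x, y)).
Proof. by apply: bmeas_comp; exact: pair1_measurable. Qed.

Lemma bmeas_pair2 (f : T1 * T2 -> R) y : bmeas f -> bmeas (fun x => f (x, y)).
Proof. by apply: bmeas_comp; exact: pair2_measurable. Qed.

End bmeas_prod.

Section prob_integral.
Context {R : realType} {d} {T : measurableType d} (P : probability T R).
Implicit Types f g : T -> R.

Lemma bmeas_integrable f : bmeas f -> P.-integrable setT (EFin \o f).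
Proof.
move=> [mf [B fB]]; apply: measurable_bounded_integrable => //.
  exact: fin_num_fun_lty (fin_num_measure P).
exists B; split; first exact: num_real.
by move=> x Bx y _ /=; exact: le_trans (fB y) (ltW Bx).
Qed.

Lemma int_cst (k : R) : \int[P]_x k = k.
Proof.
rewrite Rintegral_cst//.
have -> : (P : {measure set T -> \bar R}) setT = 1%E by exact: probability_setT.
by rewrite mulr1.
Qed.

Lemma intD f g : bmeas f -> bmeas g ->
  \int[P]_x (f x + g x) = \int[P]_x f x + \int[P]_x g x.
Proof. by move=> *; apply: RintegralD => //; exact: bmeas_integrable. Qed.

Lemma intB f g : bmeas f -> bmeas g ->
  \int[P]_x (f x - g x) = \int[P]_x f x - \int[P]_x g x.
Proof. by move=> *; apply: RintegralB => //; exact: bmeas_integrable. Qed.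

Lemma intZ k f : bmeas f -> \int[P]_x (k * f x) = k * \int[P]_x f x.
Proof. by move=> *; apply: RintegralZl => //; exact: bmeas_integrable. Qed.

Lemma le_int f g : bmeas f -> bmeas g -> (forall x, f x <= g x) ->
  \int[P]_x f x <= \int[P]_x g x.
Proof. by move=> *; apply: le_Rintegral => //; exact: bmeas_integrable. Qed.

Lemma eq_int f g : f =1 g -> \int[P]_x f x = \int[P]_x g x.
Proof. by move=> fg; apply: eq_Rintegral => x _; exact: fg. Qed.

Lemma int_bounds f a b : bmeas f -> (forall x, a <= f x <= b) ->
  a <= \int[P]_x f x <= b.
Proof.
move=> bf fab; rewrite -{1}(int_cst a) -(int_cst b).
by apply/andP; split; apply: le_int => //; try exact: bmeas_cst;
  move=> x; case/andP: (fab x).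
Qed.

End prob_integral.

Section prob_fubini.
Context {R : realType} {d1 d2} {T1 : measurableType d1} {T2 : measurableType d2}.
Variables (P : probability T1 R) (Q : probability T2 R).

Lemma bmeas_integrable_prod (f : T1 * T2 -> R) :
  bmeas f -> (P \x Q)%E.-integrable setT (EFin \o f).
Proof.
move=> [mf [B fB]]; apply: measurable_bounded_integrable => //.
  rewrite -setXTT [ltLHS]product_measure1E//.
  rewrite lte_mul_pinfty//; first exact: fin_num_measure.
  exact: fin_num_fun_lty (fin_num_measure Q).
exists B; split; first exact: num_real.
by move=> x Bx y _ /=; exact: le_trans (fB y) (ltW Bx).
Qed.

Lemma bmeas_int2 (f : T1 * T2 -> R) :
  bmeas f -> bmeas (fun x => \int[Q]_y f (x, y)).
Proof.
move=> bf; split.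
  exact: (measurableT_comp (fine_measurable measurableT)
    (measurable_fubini_F (bmeas_integrable_prod bf))).
have [_ [B fB]] := bf; exists B => x; rewrite ler_norml.
apply: int_bounds; first exact: bmeas_pair1.
by move=> y; rewrite -ler_norml.
Qed.

Lemma int_prod12 (f : T1 * T2 -> R) : bmeas f ->
  \int[(P \x Q)%E]_p f p = \int[P]_x \int[Q]_y f (x, y).
Proof.
move=> bf; rewrite /Rintegral -(integral12_prod_meas1 (bmeas_integrable_prod bf)).
congr fine; apply: eq_integral => x _ /=; rewrite fineK//.
apply: integrable_fin_num => //; apply: bmeas_integrable.
exact: (@bmeas_pair1 _ _ _ _ _ f x).
Qed.

Lemma int_prod21 (f : T1 * T2 -> R) : bmeas f ->
  \int[(P \x Q)%E]_p f p = \int[Q]_y \int[P]_x f (x, y).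
Proof.
move=> bf; rewrite /Rintegral -(integral21_prod_meas1 (bmeas_integrable_prod bf)).
congr fine; apply: eq_integral => x _ /=; rewrite fineK//.
apply: integrable_fin_num => //; apply: bmeas_integrable.
exact: (@bmeas_pair2 _ _ _ _ _ f x).
Qed.

End prob_fubini.

(** Leaves are closed by [assumption], so the facts on transforms are put into the context before
    each call. The pattern for differences precedes the one for sums, which would also match
    them. *)
Ltac bm :=
  cbv beta; lazymatch goal with
  | |- bmeas (fun x => expR (@?f x)) => refine (@bmeas_expR _ _ _ f _); bm
  | |- bmeas (fun x => @?f x + - @?g x) => refine (@bmeasB _ _ _ f g _ _); bm
  | |- bmeas (fun x => @?f x + @?g x) => refine (@bmeasD _ _ _ f g _ _); bm
  | |- bmeas (fun x => - @?f x) => refine (@bmeasN _ _ _ f _); bm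
  | |- bmeas (fun x => @?f x * @?g x) => refine (@bmeasM _ _ _ f g _ _); bm
  | |- bmeas (fun x => @?f x ^+ _) => refine (@bmeasX _ _ _ f _ _); bm
  | |- bmeas (fun p => ?f p.1) => first [assumption|refine (@bmeas_fst _ _ _ _ _ f _); bm]
  | |- bmeas (fun p => ?f p.2) => first [assumption|refine (@bmeas_snd _ _ _ _ _ f _); bm]
  | |- bmeas (fun _ => ?k) => exact: (bmeas_cst k)
  | |- _ => assumption
  end.

(** * Entropic transforms and the semi-dual functional *)

Section transform.
Context {R : realType} {d1 d2} {T1 : measurableType d1} {T2 : measurableType d2}.
Variables (mu : probability T1 R) (nu : probability T2 R).
Variables (c : T1 -> T2 -> R) (lambda : R).
Hypothesis bc : bmeas (fun p : T1 * T2 => c p.1 p.2).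
Hypothesis lambda_gt0 : 0 < lambda.

Local Notation trf := (transform_r nu c lambda).

Lemma bmeas_cost x : bmeas (c x).
Proof. exact: (bmeas_pair1 x bc). Qed.
Local Hint Resolve bmeas_cost : core.

Lemma bmeas_gibbs phi psi : bmeas phi -> bmeas psi ->
  bmeas (fun p : T1 * T2 => expR ((phi p.1 + psi p.2 - c p.1 p.2) / lambda)).
Proof. by move=> ? ?; bm. Qed.

Lemma bmeas_gibbs_section r psi x : bmeas psi ->
  bmeas (fun y => expR ((r + psi y - c x y) / lambda)).
Proof. by move=> ?; have ? := bmeas_cost x; bm. Qed.

(** Raising the potential by [r] multiplies the mass by [expR (r / lambda)], so [trf psi x] is the
    unique shift giving unit mass. Estimates on transforms are read off from masses through this
    identity. *)
Lemma trf_mass_shift psi x r : bmeas psi ->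
  \int[nu]_y expR ((r + psi y - c x y) / lambda) = expR ((r - trf psi x) / lambda).
Proof.
move=> bpsi.
have bx := bmeas_cost x.
have bZ : bmeas (fun y => expR ((psi y - c x y) / lambda)) by bm.
(* Positivity is what allows the logarithm in the transform to be undone. *)
have Zgt0 : 0 < \int[nu]_y expR ((psi y - c x y) / lambda).
  have [_ [B gB]] : bmeas (fun y => (psi y - c x y) / lambda) by bm.
  have /andP[+ _] : expR (- B) <= \int[nu]_y expR ((psi y - c x y) / lambda)
      <= expR B.
    apply: int_bounds => // y; rewrite !ler_expR.
    by have := gB y; rewrite ler_norml.
  exact/lt_le_trans/expR_gt0.
transitivity (\int[nu]_y (expR (r / lambda) * expR ((psi y - c x y) / lambda))).
  by apply: eq_int => y; rewrite -expRD -mulrDl addrA.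
rewrite intZ// /transform_r mulNr opprK mulrDl expRD mulrAC mulfV ?gt_eqF// mul1r.
by rewrite lnK.
Qed.

Lemma trf_mass psi x : bmeas psi ->
  \int[nu]_y expR ((trf psi x + psi y - c x y) / lambda) = 1.
Proof. by move=> bpsi; rewrite trf_mass_shift// subrr mul0r expR0. Qed.

(** The mass of [psi1] at [x1] for the shift [trf psi0 x0 - s] is at most the unit mass of [psi0] at
    [x0]. Letting point and potential vary together covers both oscillation bounds and comparisons
    of two transforms. *)
Lemma trf_le psi0 psi1 x0 x1 s : bmeas psi0 -> bmeas psi1 ->
  (forall y, psi1 y - c x1 y <= psi0 y - c x0 y + s) ->
  trf psi0 x0 <= trf psi1 x1 + s.
Proof.
move=> b0 b1 h; rewrite -subr_le0 -(pmulr_lle0 _ (_ : 0 < lambda^-1)) ?invr_gt0//.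
rewrite -ler_expR expR0 opprD addrA addrAC -trf_mass_shift// -(trf_mass x0 b0).
apply: le_int; try exact: bmeas_gibbs_section.
move=> y; rewrite ler_expR ler_pM2r ?invr_gt0//.
by have := h y; lra.
Qed.

Lemma le_trf psi x r : bmeas psi ->
  \int[nu]_y expR ((r + psi y - c x y) / lambda) <= 1 -> r <= trf psi x.
Proof.
move=> bpsi; rewrite trf_mass_shift// -expR0 ler_expR pmulr_lle0 ?invr_gt0//.
by rewrite subr_le0.
Qed.

Lemma trf_osc psi K x0 x1 : bmeas psi ->
  (forall y, c x0 y - c x1 y <= K) -> trf psi x0 <= trf psi x1 + K.
Proof. by move=> bpsi h; apply: trf_le => // y; have := h y; lra. Qed.

Lemma bmeas_trf psi : bmeas psi -> bmeas (trf psi).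
Proof.
move=> bpsi; split.
  apply: measurable_funM; first exact: measurable_cst.
  apply: (measurableT_comp (@measurable_ln R)).
  have /(bmeas_int2 mu nu)[] // : bmeas (fun p : T1 * T2 => expR ((psi p.2 - c p.1 p.2) / lambda)).
  by bm.
have [_ [B gB]] : bmeas (fun p : T1 * T2 => psi p.2 - c p.1 p.2) by bm.
exists B => x; have bx := bmeas_cost x.
have hx y : - B <= psi y - c x y <= B by have := gB (x, y); rewrite ler_norml.
rewrite ler_norml; apply/andP; split.
  apply: le_trf => //; rewrite -[leRHS](int_cst nu).
  apply: le_int; [exact: bmeas_gibbs_section|bm|move=> y].
  rewrite -expR0 ler_expR pmulr_lle0 ?invr_gt0//.
  by have := hx y; lra.
rewrite -subr_le0 -(pmulr_lle0 _ (_ : 0 < lambda^-1)) ?invr_gt0//.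
rewrite -(ler_expR _ 0) expR0 -opprB mulNr expRN invf_le1 ?expR_gt0//.
rewrite -trf_mass_shift// -[leLHS](int_cst nu).
apply: le_int; [bm|exact: bmeas_gibbs_section|move=> y].
rewrite -expR0 ler_expR pmulr_lge0 ?invr_gt0//.
by have := hx y; lra.
Qed.

End transform.

Section entropic_dual.
Context {R : realType} {d1 d2} {T1 : measurableType d1} {T2 : measurableType d2}.
Variables (mu : probability T1 R) (nu : probability T2 R).
Variables (c : T1 -> T2 -> R) (lambda : R).
Hypothesis bc : bmeas (fun p : T1 * T2 => c p.1 p.2).
Hypothesis lambda_gt0 : 0 < lambda.

Local Notation trl := (transform_r nu c lambda).
Local Notation trr := (transform_l mu c lambda).
Local Notation dual := (dual mu nu c lambda).
Local Notation "'\iint_' p F" := (\int[(mu \x nu)%E]_p F)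
  (at level 36, p name, F at level 36).
Local Notation gibbs phi psi p :=
  (expR ((phi p.1 + psi p.2 - c p.1 p.2) / lambda)).

(** [transform_l] is [transform_r] for the transposed cost, so its properties follow from those
    already proved. *)
Lemma bmeas_swap : bmeas (fun p : T2 * T1 => c p.2 p.1).
Proof. have := bmeas_comp (@measurable_swap _ _ T2 T1) bc; exact. Qed.

Lemma bmeas_trl psi : bmeas psi -> bmeas (trl psi).
Proof. exact: bmeas_trf. Qed.

Lemma bmeas_trr phi : bmeas phi -> bmeas (trr phi).
Proof. exact: (bmeas_trf nu mu (c := fun y x => c x y) bmeas_swap). Qed.

Lemma trr_osc phi K y y' : bmeas phi ->
  (forall x, c x y - c x y' <= K) -> trr phi y <= trr phi y' + K.
Proof. exact: (trf_osc mu (c := fun y x => c x y) bmeas_swap). Qed.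

Lemma trr_mass_shift phi y r : bmeas phi ->
  \int[mu]_x expR ((phi x + r - c x y) / lambda) = expR ((r - trr phi y) / lambda).
Proof.
move=> bphi.
have := trf_mass_shift mu (c := fun y x => c x y) bmeas_swap lambda_gt0 y r bphi; rewrite /transform_r /transform_l => <-.
by apply: eq_int => x; rewrite (addrC r).
Qed.

(** The first marginal of the Gibbs density has density [expR ((phi x - trl psi x) / lambda)] with
    respect to [mu]; it is [mu] itself when [phi] is [trl psi]. *)
Lemma iint_l (a : T1 -> R) phi psi : bmeas a -> bmeas phi -> bmeas psi ->
  \iint_p (gibbs phi psi p * a p.1) =
  \int[mu]_x (expR ((phi x - trl psi x) / lambda) * a x).
Proof.
move=> ba bphi bpsi; rewrite int_prod12/=; last by bm.
apply: eq_int => x; rewrite -(trf_mass_shift nu bc lambda_gt0)// mulrC.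
have bs := bmeas_gibbs_section lambda bc (phi x) x bpsi.
by rewrite -intZ//; apply: eq_int => y; rewrite mulrC.
Qed.

Lemma iint_r (b : T2 -> R) phi psi : bmeas b -> bmeas phi -> bmeas psi ->
  \iint_p (gibbs phi psi p * b p.2) =
  \int[nu]_y (expR ((psi y - trr phi y) / lambda) * b y).
Proof.
move=> bb bphi bpsi; rewrite int_prod21/=; last by bm.
apply: eq_int => y; rewrite -trr_mass_shift// mulrC.
have bs : bmeas (fun x => expR ((phi x + psi y - c x y) / lambda)).
  by have ? : bmeas (c^~ y) := bmeas_pair2 y bc; bm.
by rewrite -intZ//; apply: eq_int => x; rewrite mulrC.
Qed.

Lemma mass_l phi psi : bmeas phi -> bmeas psi ->
  \iint_p gibbs phi psi p = \int[mu]_x expR ((phi x - trl psi x) / lambda).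
Proof.
move=> ? ?; rewrite int_prod12/=; last by bm.
by apply: eq_int => x; rewrite trf_mass_shift.
Qed.

Lemma mass_r phi psi : bmeas phi -> bmeas psi ->
  \iint_p gibbs phi psi p = \int[nu]_y expR ((psi y - trr phi y) / lambda).
Proof.
move=> ? ?; rewrite int_prod21/=; last by bm.
by apply: eq_int => x; rewrite trr_mass_shift.
Qed.

Lemma mass_trl psi : bmeas psi -> \iint_p gibbs (trl psi) psi p = 1.
Proof.
move=> bpsi; rewrite mass_l//; last exact: bmeas_trl.
under eq_int do rewrite subrr mul0r expR0; exact: int_cst.
Qed.

Lemma mass_trr phi : bmeas phi -> \iint_p gibbs phi (trr phi) p = 1.
Proof.
move=> bphi; rewrite mass_r//; last exact: bmeas_trr.
under eq_int do rewrite subrr mul0r expR0; exact: int_cst.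
Qed.

Lemma iintD f g : bmeas f -> bmeas g ->
  \iint_p (f p + g p) = \iint_p f p + \iint_p g p.
Proof. by move=> *; apply: RintegralD => //; exact: bmeas_integrable_prod. Qed.

Lemma iintB f g : bmeas f -> bmeas g ->
  \iint_p (f p - g p) = \iint_p f p - \iint_p g p.
Proof. by move=> *; apply: RintegralB => //; exact: bmeas_integrable_prod. Qed.

Lemma iintZ k f : bmeas f -> \iint_p (k * f p) = k * \iint_p f p.
Proof. by move=> *; apply: RintegralZl => //; exact: bmeas_integrable_prod. Qed.

Lemma le_iint f g : bmeas f -> bmeas g -> (forall p, f p <= g p) ->
  \iint_p f p <= \iint_p g p.
Proof. by move=> *; apply: le_Rintegral => //; exact: bmeas_integrable_prod. Qed.

(* This is nonnegativity of the relative entropy of two Gibbs densities. *)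
Lemma gibbs_inequality phi0 psi0 phi1 psi1 :
  bmeas phi0 -> bmeas psi0 -> bmeas phi1 -> bmeas psi1 ->
  \iint_p gibbs phi0 psi0 p = \iint_p gibbs phi1 psi1 p ->
  0 <= \iint_p (gibbs phi1 psi1 p *
                (phi1 p.1 - phi0 p.1 + (psi1 p.2 - psi0 p.2))).
Proof.
move=> b0 b0' b1 b1' eqm.
have g0 : bmeas (fun p => gibbs phi0 psi0 p) by exact: bmeas_gibbs.
have g1 : bmeas (fun p => gibbs phi1 psi1 p) by exact: bmeas_gibbs.
(* Writing 0 as [lambda] times the difference of the two equal masses makes the inequality
   pointwise, a case of exp(-u) >= 1 - u. *)
rewrite -(mulr0 lambda) -(subrr (\iint_p gibbs phi0 psi0 p)).
rewrite {1}eqm -iintB// -iintZ; last by bm.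
apply: le_iint; [by bm|by bm|move=> p].
set w := _ + (_ - _).
have -> : gibbs phi0 psi0 p = gibbs phi1 psi1 p * expR (- (w / lambda)).
  by rewrite -expRD; congr expR; rewrite /w; ring.
have := expR_ge1Dx (- (w / lambda)) => h.
rewrite -{1}(mulr1 (gibbs phi1 psi1 p)) -mulrBr mulrCA ler_pM2l ?expR_gt0//.
apply: (@le_trans _ _ (lambda * (w / lambda))).
  by rewrite ler_pM2l//; lra.
by rewrite mulrCA mulfV ?gt_eqF// mulr1.
Qed.

Definition semidual psi := \int[mu]_x trl psi x + \int[nu]_y psi y.
Definition sink psi := trr (trl psi).
Definition sink_gain psi := \int[nu]_y (sink psi y - psi y).

Lemma bmeas_sink psi : bmeas psi -> bmeas (sink psi).
Proof. by move=> bpsi; exact/bmeas_trr/bmeas_trl. Qed.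

Lemma dual_trl psi : bmeas psi -> dual (trl psi) psi = semidual psi.
Proof. by move=> bpsi; rewrite /Defs.dual mass_trl// subrr mulr0 addr0. Qed.

(** For fixed [psi] the transform maximises the dual functional: exp(u) >= 1 + u is integrated with
    u = (phi - trl psi) / lambda. *)
Lemma dual_le_semidual phi psi : bmeas phi -> bmeas psi ->
  dual phi psi <= semidual psi.
Proof.
move=> bphi bpsi; have bl := bmeas_trl bpsi.
rewrite /Defs.dual /semidual addrAC lerD2r mass_l//.
have h : 1 + lambda^-1 * (\int[mu]_x phi x - \int[mu]_x trl psi x) <=
    \int[mu]_x expR ((phi x - trl psi x) / lambda).
  rewrite -intB// -intZ; last by bm.
  rewrite -{1}(int_cst mu 1) -intD; [|by bm..].
  by apply: le_int => [||x]; [by bm|by bm|rewrite mulrC; exact: expR_ge1Dx].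
have := ler_wpM2l (ltW lambda_gt0) h.
rewrite mulrDr mulrA mulfV ?gt_eqF// mul1r; lra.
Qed.

(** The left side is the dual functional at [trl psi] and [sink psi], a pair of unit mass;
    reoptimising its first component can only increase the value. *)
Lemma semidual_sink psi : bmeas psi ->
  semidual psi + sink_gain psi <= semidual (sink psi).
Proof.
move=> bpsi; have bl := bmeas_trl bpsi; have bs := bmeas_sink bpsi.
have := dual_le_semidual bl bs.
rewrite /Defs.dual mass_trr// subrr mulr0 addr0.
apply: le_trans; rewrite /sink_gain intB// /semidual; lra.
Qed.

(* With [P] the coupling [gibbs (trl psi) (sink psi)], the gain of the first
   step dominates, and that of the next step is dominated by, the integral of
   [trl psi - trl (sink psi)] against [P]. *)
Lemma sink_gain_sink psi : bmeas psi -> sink_gain (sink psi) <= sink_gain psi.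
Proof.
move=> bpsi.
(* Each potential is named by a variable with an equation, so that later goals contain atoms instead
   of nested transforms. *)
have [phi phiE] : exists f, f = trl psi by exact: (ex_intro _ (trl psi) erefl).
have [psi' psi'E] : exists f, f = trr phi by exact: (ex_intro _ (trr phi) erefl).
have [phi' phi'E] : exists f, f = trl psi' by exact: (ex_intro _ (trl psi') erefl).
have [psi'' psi''E] : exists f, f = trr phi' by exact: (ex_intro _ (trr phi') erefl).
have b2 : bmeas phi by rewrite phiE; exact: bmeas_trl.
have b1 : bmeas psi' by rewrite psi'E; exact: bmeas_trr.
have b3 : bmeas phi' by rewrite phi'E; exact: bmeas_trl.
have b4 : bmeas psi'' by rewrite psi''E; exact: bmeas_trr.
rewrite /sink_gain /sink -phiE -psi'E -phi'E -psi''E.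
have gP : bmeas (fun p => gibbs phi psi' p) by exact: bmeas_gibbs.
have mP : \iint_p gibbs phi psi' p = 1 by rewrite psi'E mass_trr.
(* The second marginal of P is [nu], because [psi'] is the transform of [phi]. *)
have gain (b : T2 -> R) : bmeas b ->
    \iint_p (gibbs phi psi' p * b p.2) = \int[nu]_y b y.
  move=> bb; rewrite iint_r//; apply: eq_int => y.
  by rewrite -psi'E subrr mul0r expR0 mul1r.
(* First half: the relative entropy of P with respect to the coupling of [phi'] and [psi''] is
   nonnegative. *)
apply: (@le_trans _ _ (\iint_p (gibbs phi psi' p * (phi p.1 - phi' p.1)))).
  rewrite -gain; last by bm.
  rewrite -subr_ge0 -iintB; [|by bm..].
  have /(gibbs_inequality b3 b4 b2 b1) :
      \iint_p gibbs phi' psi'' p = \iint_p gibbs phi psi' p.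
    by rewrite mP psi''E mass_trr.
  move/le_trans; apply; apply: le_iint => [||p]; [by bm|by bm|rewrite -mulrBr].
  by apply: ler_wpM2l; [exact: expR_ge0|lra].
rewrite -gain; last by bm.
rewrite -subr_ge0 -iintB; [|by bm..].
(* Second half: paired with [psi], the potential 2 phi - phi' has the same first marginal exp((phi -
   phi') / lambda) as P, hence the same mass, and phi - phi2 is the opposite of phi - phi'. *)
have [phi2 phi2E] : exists f, f = fun x => 2 * phi x - phi' x
  by exists (fun x => 2 * phi x - phi' x).
have b5 : bmeas phi2 by rewrite phi2E; bm.
have /(gibbs_inequality b5 bpsi b2 b1) :
    \iint_p gibbs phi2 psi p = \iint_p gibbs phi psi' p.
  rewrite (mass_l b5 bpsi) (mass_l b2 b1) -phiE -phi'E phi2E.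
  apply: eq_int => x.
  by rewrite (_ : _ - phi x = phi x - phi' x)//; lra.
move/le_trans; apply; apply: le_iint => [||p]; [by bm|by bm|rewrite -mulrBr].
by apply: ler_wpM2l; [exact: expR_ge0|rewrite phi2E; lra].
Qed.

End entropic_dual.

(** * The gap is controlled by the gain *)

Section elementary_bounds.
Context {R : realType}.
Implicit Types a u z : R.

Lemma expR_half u : expR u = expR (u / 2) ^+ 2.
Proof. by rewrite expr2 -expRD; congr expR; lra. Qed.

(* The exponential form of [a - a^2 <= ln (1 + a)]. *)
Lemma expR_sub_sqr_le a : `|a| <= 1 / 4 -> expR (a - a ^+ 2) <= 1 + a.
Proof.
rewrite ler_norml => /andP[a1 a2].
have a0 : 0 < 1 + a by lra.
have e0 := expR_gt0 (a - a ^+ 2).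
(* With v = a - a^2, the bound exp(-v) >= 1 - v suffices for a >= 0, since (1 + a)(1 - v) = 1 +
   a^3. *)
have [a_ge0|a_lt0] := leP 0 a.
  have h := expR_ge1Dx (- (a - a ^+ 2)); rewrite expRN in h.
  have : 1 <= (1 + a) * (1 + - (a - a ^+ 2)).
    have -> : (1 + a) * (1 + - (a - a ^+ 2)) = 1 + a ^+ 3 by ring.
    by rewrite lerDl exprn_ge0.
  move/le_trans/(_ (ler_wpM2l (ltW a0) h)).
  by rewrite ler_pdivlMr// mul1r.
(* For a = - s < 0 the sharper bound exp(-v) >= (1 - v/2)^2 is used; the excess over 1 is (s^2 - 3
   s^3 - s^4 - s^5) / 4, nonnegative for s <= 1/4. *)
have h := expR_ge1Dx (- (a - a ^+ 2) / 2).
have [s as0 [s0 s1]] : exists2 s, a = - s & 0 < s /\ s <= 1 / 4.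
  by exists (- a); [|split]; lra.
have s2 : 0 <= s ^+ 2 by exact: sqr_ge0.
have h2 : (1 + - (a - a ^+ 2) / 2) ^+ 2 <= (expR (a - a ^+ 2))^-1.
  rewrite -expRN (expR_half (- _)) lerXn2r ?nnegrE ?expR_ge0//.
  by rewrite as0 sqrrN; lra.
have : 1 <= (1 + a) * (1 + - (a - a ^+ 2) / 2) ^+ 2.
  have s3 : s ^+ 2 * s <= s ^+ 2 * (1 / 4) by rewrite ler_wpM2l.
  have s4 : s ^+ 2 * s * s <= s ^+ 2 * (1 / 4).
    by rewrite -mulrA ler_wpM2l//; nra.
  have s5 : s ^+ 2 * s * s * s <= s ^+ 2 * s * s.
    rewrite -[leRHS]mulr1 ler_wpM2l//; last by lra.
    by rewrite !mulr_ge0// ltW.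
  have s4' : s ^+ 2 * s * s <= s ^+ 2 * (1 / 16).
    by rewrite -mulrA ler_wpM2l//; nra.
  have -> : (1 + a) * (1 + - (a - a ^+ 2) / 2) ^+ 2 =
    1 + (s ^+ 2 - 3 * (s ^+ 2 * s) - s ^+ 2 * s * s - s ^+ 2 * s * s * s) / 4.
    by rewrite as0; field.
  by lra.
move/le_trans/(_ (ler_wpM2l (ltW a0) h2)).
by rewrite ler_pdivlMr// mul1r.
Qed.

(** Pointwise entropy duality for a density q = exp(-z): the right side is q - 1 - ln q plus a
    quadratic cost. It combines exp(w) >= 1 + w at w = a - a^2 - z with the preceding bound. *)
Lemma young_expR a z : `|a| <= 1 / 4 ->
  a * (1 - expR (- z)) <= expR (- z) - 1 + z + a ^+ 2.
Proof.
move=> ha.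
have h : (1 + - (z - (a - a ^+ 2))) <= (1 + a) * expR (- z).
  apply: (@le_trans _ _ (expR (- (z - (a - a ^+ 2))))).
    exact: expR_ge1Dx.
  rewrite opprB expRB expRN ler_wpM2r ?invr_ge0 ?expR_ge0//.
  exact: expR_sub_sqr_le.
by rewrite mulrDl mul1r in h; rewrite mulrBr mulr1; lra.
Qed.

(** A converse to the quadratic behaviour at 0; the factor must grow with [U] because exp(-u) - 1 +
    u is only linear for large u. Up to u = 2 the square of 1 - u/2 gives the factor 4; beyond, the
    exponential is dropped. *)
Lemma sqr_le_expR u U : `|u| <= U ->
  u ^+ 2 <= (4 + 3 / 2 * U) * (expR (- u) - 1 + u).
Proof.
rewrite ler_norml => /andP[u1 u2].
have U0 : 0 <= U by lra.
have e0 : 0 <= expR (- u) - 1 + u by have := expR_ge1Dx (- u); lra.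
have [u_le2|u_gt2] := leP u 2.
  have h : u ^+ 2 / 4 <= expR (- u) - 1 + u.
    have h := expR_ge1Dx (- u / 2).
    have : (1 + - u / 2) ^+ 2 <= expR (- u).
      by rewrite (expR_half (- u)) lerXn2r ?nnegrE ?expR_ge0//; lra.
    by rewrite !expr2; lra.
  apply: (@le_trans _ _ (4 * (expR (- u) - 1 + u))); first by lra.
  by apply: ler_wpM2r => //; lra.
have e1 := expR_gt0 (- u).
apply: (@le_trans _ _ ((4 + 3 / 2 * u) * (u - 1))).
  by rewrite expr2; nra.
by apply: ler_pM; lra.
Qed.

End elementary_bounds.

Section gap_estimate.
Context {R : realType} {d1 d2} {T1 : measurableType d1} {T2 : measurableType d2}.
Variables (mu : probability T1 R) (nu : probability T2 R).
Variables (c : T1 -> T2 -> R) (lambda K rho S : R).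
Hypothesis bc : bmeas (fun p : T1 * T2 => c p.1 p.2).
Hypothesis lambda_gt0 : 0 < lambda.
Hypothesis K_ge0 : 0 <= K.
Hypothesis rho_ge1 : 1 <= rho.
Hypothesis c_osc : forall x x' y y', c x y - c x' y' <= K.

Local Notation trl := (transform_r nu c lambda).
Local Notation trr := (transform_l mu c lambda).
Local Notation E := (semidual mu nu c lambda).
Local Notation sink := (sink mu nu c lambda).
Local Notation gain := (sink_gain mu nu c lambda).
Local Notation "'\iint_' p F" := (\int[(mu \x nu)%E]_p F)
  (at level 36, p name, F at level 36).
Local Notation gibbs phi psi p :=
  (expR ((phi p.1 + psi p.2 - c p.1 p.2) / lambda)).

(** [S] is the supremum of the semi-dual functional, given as an upper bound that is approximated;
    near maximisers replace a maximiser. *)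
Hypothesis S_ub : forall psi, bmeas psi -> E psi <= S.
Hypothesis S_approx : forall e, 0 < e -> exists2 psi, bmeas psi & S - e <= E psi.

Definition osc_le (psi : T2 -> R) := forall y y', psi y - psi y' <= K.

(* The variance bound that Prekopa-Leindler gives on convex supports. *)
Hypothesis trl_variance : forall psi0 psi1, bmeas psi0 -> bmeas psi1 ->
  osc_le psi0 -> osc_le psi1 -> exists k,
  \int[mu]_x (trl psi1 x - trl psi0 x - k) ^+ 2 <= 38 * rho * K *
  \int[mu]_x (trl (fun y => (psi0 y + psi1 y) / 2) x - (trl psi0 x + trl psi1 x) / 2).

Lemma osc_sink psi : bmeas psi -> osc_le (sink psi).
Proof.
move=> bpsi y y'; rewrite lerBlDl.
have bl := bmeas_trl mu nu bc lambda_gt0 bpsi.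
have cK x : c x y - c x y' <= K by exact: c_osc.
exact: (trr_osc mu bc lambda_gt0 bl cK).
Qed.

(** The integrand is the density, with respect to [nu], of the second marginal of the coupling of
    [trl psi] and [psi]. *)
Lemma int_sink_density psi : bmeas psi ->
  \int[nu]_y expR (- ((sink psi y - psi y) / lambda)) = 1.
Proof.
move=> bpsi; have bl := bmeas_trl mu nu bc lambda_gt0 bpsi.
rewrite -[RHS](mass_trl mu nu bc lambda_gt0 bpsi) (mass_r mu nu bc lambda_gt0)//.
by apply: eq_int => y; rewrite -[- (_ / lambda)]mulNr opprB.
Qed.

Lemma gain_ge0 psi : bmeas psi -> 0 <= gain psi.
Proof.
move=> bpsi; have bs := bmeas_sink mu nu bc lambda_gt0 bpsi.
set z := fun y => sink psi y - psi y; have bz : bmeas z by rewrite /z; bm.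
have bq : bmeas (fun y => expR (- (z y / lambda))) by bm.
have bq' : bmeas (fun y => lambda * (1 - expR (- (z y / lambda)))) by bm.
have -> : 0 = \int[nu]_y (lambda * (1 - expR (- (z y / lambda)))).
  rewrite intZ; last by bm.
  by rewrite intB ?int_cst ?int_sink_density ?subrr ?mulr0//; bm.
apply: le_int => // y.
rewrite -/(z y) -[leRHS](mulKf (lt0r_neq0 lambda_gt0)) mulrCA ler_pM2l//.
have := expR_ge1Dx (- (z y / lambda)); rewrite mulrC; lra.
Qed.

(* The Donsker-Varadhan variational bound for the density [expR (- z / lambda)],
   specialized to the bounded test function [theta * b]. *)
Lemma deviation_le z b theta : bmeas z -> bmeas b -> 0 < theta ->
  \int[nu]_y expR (- (z y / lambda)) = 1 ->
  (forall y, `|theta * b y| <= 1 / 4) ->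
  \int[nu]_y (b y * (1 - expR (- (z y / lambda)))) <=
  \int[nu]_y z y / lambda / theta + theta * \int[nu]_y (b y ^+ 2).
Proof.
move=> bz bb theta0 iq hb.
have bq : bmeas (fun y => expR (- (z y / lambda))) by bm.
have bb2 : bmeas (fun y => b y ^+ 2) by bm.
rewrite -(ler_pM2l theta0) mulrDr mulrCA mulfV ?gt_eqF// mulr1.
rewrite -intZ; last by bm.
rewrite (mulrC _ lambda^-1) -[X in _ <= X + _]intZ; last by bm.
rewrite mulrA -expr2 -[X in _ <= _ + X]intZ//.
rewrite -intD; [|by bm..].
(* The density minus 1 integrates to 0; adding it reduces the claim to [young_expR] at each point,
   with a = theta b(y). *)
have -> : \int[nu]_y (lambda^-1 * z y + theta ^+ 2 * b y ^+ 2) =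
   \int[nu]_y (expR (- (z y / lambda)) - 1 + lambda^-1 * z y + theta ^+ 2 * b y ^+ 2).
  rewrite [LHS]intD; [|by bm..]; rewrite [RHS]intD; [|by bm..]; congr (_ + _).
  rewrite [RHS]intD; [|by bm..].
  by rewrite intB ?iq ?int_cst ?subrr ?add0r//; bm.
apply: le_int; [by bm|by bm|move=> y].
by rewrite mulrA (mulrC _ (z y)) -exprMn; exact: young_expR.
Qed.

Lemma marginal_deviation psi b theta : bmeas psi -> bmeas b -> 0 < theta ->
  (forall y, `|theta * b y| <= 1 / 4) ->
  \int[nu]_y (b y * (1 - expR (- ((sink psi y - psi y) / lambda)))) <=
  gain psi / lambda / theta + theta * \int[nu]_y (b y ^+ 2).
Proof.
move=> bpsi bb theta0 hb; have bs := bmeas_sink mu nu bc lambda_gt0 bpsi.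
have bz := bmeasB bs bpsi.
exact: (deviation_le bz bb theta0 (int_sink_density bpsi) hb).
Qed.

(** One Sinkhorn step from an [e]-maximiser brings the oscillation below [K] and stays nearly
    optimal. Its own gain is at most [e], as [E] cannot exceed [S], so its second marginal is close
    to [nu] when tested on functions bounded by [B]. *)
Lemma near_optimal B eta : 0 < eta -> exists psi,
  [/\ bmeas psi, osc_le psi, S - eta <= E psi &
   forall b, bmeas b -> (forall y, `|b y| <= B) ->
   \int[nu]_y (b y * (1 - expR (- ((sink psi y - psi y) / lambda)))) <= eta].
Proof.
move=> eta0.
have aux1 (s a g b : R) : s <= a -> a + g <= b -> 0 <= g -> s <= b by lra.
have aux2 (a g b e : R) : a + g <= b -> b <= S -> S - e <= a -> g <= e by lra.
have [B' B'B B'0] : exists2 B', B <= B' & 0 < B'.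
  exists (`|B| + 1); last by rewrite ltr_pwDr.
  by rewrite (le_trans (ler_norm _))// lerDl.
(* The first entry makes theta b admissible in [marginal_deviation], the second makes the quadratic
   term at most eta / 2; [e] below does the same for the gain term. *)
pose theta := Num.min (1 / 4 / B') (eta / 2 / B' ^+ 2).
have theta0 : 0 < theta.
  by rewrite lt_min !divr_gt0// ?exprn_gt0.
pose e := Num.min eta (lambda * theta * (eta / 2)).
have e0 : 0 < e by rewrite lt_min eta0 !mulr_gt0.
have [psi bpsi hpsi] := S_approx e0.
have bs := bmeas_sink mu nu bc lambda_gt0 bpsi.
have bss := bmeas_sink mu nu bc lambda_gt0 bs.
have ps : S - e <= E (sink psi).
  exact: aux1 hpsi (semidual_sink mu nu bc lambda_gt0 bpsi) (gain_ge0 bpsi).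
have gs : gain (sink psi) <= e.
  exact: aux2 (semidual_sink mu nu bc lambda_gt0 bs) (S_ub bss) ps.
exists (sink psi); split => //; first exact: osc_sink.
  by apply: le_trans ps; rewrite lerD2l lerN2 ge_min lexx.
move=> b bb hb.
have hb' y : `|b y| <= B' by exact: le_trans (hb y) B'B.
apply: le_trans (marginal_deviation bs bb theta0 _) _.
  move=> y; rewrite normrM (ger0_norm (ltW theta0)).
  apply: (@le_trans _ _ (theta * B')); first by rewrite ler_wpM2l// ltW.
  by rewrite -ler_pdivlMr// ge_min lexx.
rewrite (splitr eta) lerD//.
  rewrite ler_pdivrMr// ler_pdivrMr// (le_trans gs)// ge_min; apply/orP; right.
  by rewrite -mulrA mulrC (mulrC theta).
rewrite mulrC -ler_pdivlMr//.
have : 0 <= \int[nu]_y b y ^+ 2 <= B' ^+ 2.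
  apply: int_bounds => [|y]; first by bm.
  by rewrite sqr_ge0/= -real_normK ?num_real// lerXn2r ?nnegrE// ltW.
case/andP=> _ /le_trans; apply.
rewrite ler_pdivlMr// mulrC -ler_pdivlMr ?exprn_gt0//.
by rewrite ge_min lexx orbT.
Qed.

(** If w is the difference of the potentials, the first Gibbs density is the second times exp(-w /
    lambda). Then [sqr_le_expR] at u = w / lambda and U = 2 K / lambda applies pointwise, and the
    difference of the densities integrates to 0. *)
Lemma weighted_sqr_le phi0 psi0 phi1 psi1 :
  bmeas phi0 -> bmeas psi0 -> bmeas phi1 -> bmeas psi1 ->
  \iint_p gibbs phi0 psi0 p = \iint_p gibbs phi1 psi1 p ->
  (forall x y, `|phi1 x - phi0 x + (psi1 y - psi0 y)| <= 2 * K) ->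
  \iint_p (gibbs phi1 psi1 p *
           (phi1 p.1 - phi0 p.1 + (psi1 p.2 - psi0 p.2)) ^+ 2) <=
  (4 * lambda + 3 * K) * \iint_p (gibbs phi1 psi1 p *
           (phi1 p.1 - phi0 p.1 + (psi1 p.2 - psi0 p.2))).
Proof.
move=> b0 b0' b1 b1' eqm hw.
have g0 : bmeas (fun p => gibbs phi0 psi0 p) by exact: bmeas_gibbs.
have g1 : bmeas (fun p => gibbs phi1 psi1 p) by exact: bmeas_gibbs.
have -> : \iint_p (gibbs phi1 psi1 p *
           (phi1 p.1 - phi0 p.1 + (psi1 p.2 - psi0 p.2))) =
  \iint_p (lambda * (gibbs phi0 psi0 p - gibbs phi1 psi1 p) + gibbs phi1 psi1 p *
           (phi1 p.1 - phi0 p.1 + (psi1 p.2 - psi0 p.2))).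
  rewrite [RHS]iintD; [|by bm..].
  rewrite iintZ; last by bm.
  by rewrite iintB// eqm subrr mulr0 add0r.
rewrite -iintZ; last by bm.
apply: le_iint; [by bm|by bm|move=> p].
have {hw} := hw p.1 p.2; set w := _ + (_ - _) => hw.
have -> : gibbs phi0 psi0 p = gibbs phi1 psi1 p * expR (- (w / lambda)).
  by rewrite -expRD; congr expR; rewrite /w; ring.
move: (gibbs phi1 psi1 p) (expR_ge0 ((phi1 p.1 + psi1 p.2 - c p.1 p.2) / lambda)) w hw => g g_ge0 w hw.
have l0 : lambda != 0 by rewrite gt_eqF.
have h : (w / lambda) ^+ 2 <=
    (4 + 3 / 2 * (2 * K / lambda)) * (expR (- (w / lambda)) - 1 + w / lambda).
  have li : 0 <= lambda^-1 by rewrite invr_ge0 ltW.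
  by apply: sqr_le_expR; rewrite normrM (ger0_norm li) ler_pM2r ?invr_gt0.
have -> : (4 * lambda + 3 * K) * (lambda * (g * expR (- (w / lambda)) - g) + g * w)
  = g * (lambda ^+ 2 * ((4 + 3 / 2 * (2 * K / lambda)) *
     (expR (- (w / lambda)) - 1 + w / lambda))).
  move: (expR _) => e; field; exact: l0.
have -> : g * w ^+ 2 = g * (lambda ^+ 2 * (w / lambda) ^+ 2).
  by rewrite -exprMn (mulrC lambda) -mulrA mulVf// mulr1.
by rewrite ler_wpM2l// ler_wpM2l// sqr_ge0.
Qed.

(** With f and v the differences of the two potentials, v + k = (f + v) - (f - k). *)
Lemma weighted_shift_le (phi0 phi1 : T1 -> R) (psi0 psi1 : T2 -> R) k :
  bmeas phi0 -> bmeas psi0 -> bmeas phi1 -> bmeas psi1 ->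
  \iint_p (gibbs phi1 psi1 p * (psi1 p.2 - psi0 p.2 + k) ^+ 2) <=
  2 * \iint_p (gibbs phi1 psi1 p *
           (phi1 p.1 - phi0 p.1 + (psi1 p.2 - psi0 p.2)) ^+ 2) +
  2 * \iint_p (gibbs phi1 psi1 p * (phi1 p.1 - phi0 p.1 - k) ^+ 2).
Proof.
move=> b0 b0' b1 b1'.
have g1 : bmeas (fun p => gibbs phi1 psi1 p) by exact: bmeas_gibbs.
rewrite -iintZ; last by bm.
rewrite -[X in _ <= _ + X]iintZ; last by bm.
rewrite -iintD; [|by bm..].
apply: le_iint; [by bm|by bm|move=> p].
move: (gibbs phi1 psi1 p) (expR_ge0 ((phi1 p.1 + psi1 p.2 - c p.1 p.2) / lambda)) => g g_ge0.
move: (phi1 p.1 - phi0 p.1) (psi1 p.2 - psi0 p.2) => f v.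
have -> : 2 * (g * (f + v) ^+ 2) + 2 * (g * (f - k) ^+ 2) =
  g * (2 * (f + v) ^+ 2 + 2 * (f - k) ^+ 2) by ring.
rewrite ler_wpM2l// -subr_ge0.
have -> : 2 * (f + v) ^+ 2 + 2 * (f - k) ^+ 2 - (v + k) ^+ 2 =
  (2 * f + v - k) ^+ 2 by ring.
exact: sqr_ge0.
Qed.

(** psi1 - psi0 varies by at most 2 K, and the transform turns an added constant into a subtracted
    one, so the constants cancel in the sum. *)
Lemma trl_diff_bound psi0 psi1 : bmeas psi0 -> bmeas psi1 ->
  osc_le psi0 -> osc_le psi1 -> forall x y,
  `|trl psi1 x - trl psi0 x + (psi1 y - psi0 y)| <= 2 * K.
Proof.
move=> b0 b1 o0 o1 x y.
have auxl (a b v : R) : b <= a + (v + 2 * K) -> - (2 * K) <= a - b + v by lra.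
have auxr (a b v : R) : a <= b + (2 * K - v) -> a - b + v <= 2 * K by lra.
rewrite ler_norml; apply/andP; split.
  apply: auxl; apply: (trf_le nu bc lambda_gt0 b0 b1) => y'.
  by have := o1 y' y; have := o0 y y'; lra.
apply: auxr; apply: (trf_le nu bc lambda_gt0 b1 b0) => y'.
by have := o1 y y'; have := o0 y' y; lra.
Qed.

Lemma int_sqr_mean_le (f : T1 -> R) k : bmeas f ->
  \int[mu]_x (f x - \int[mu]_z f z) ^+ 2 <= \int[mu]_x (f x - k) ^+ 2.
Proof.
move=> bf; move E : (\int[mu]_z f z) => e.
have -> : \int[mu]_x (f x - k) ^+ 2 =
    \int[mu]_x ((f x - e) ^+ 2 + (2 * (e - k) * (f x - e) + (e - k) ^+ 2)).
  by apply: eq_int => x; ring.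
rewrite intD; [|by bm..].
rewrite [X in _ + X]intD; [|by bm..].
rewrite intZ; last by bm.
rewrite intB; [|by bm..].
by rewrite E !int_cst subrr mulr0 add0r lerDl sqr_ge0.
Qed.

Lemma iint_gibbs_trl psi a : bmeas psi -> bmeas a ->
  \iint_p (gibbs (trl psi) psi p * a p.1) = \int[mu]_x a x.
Proof.
move=> bpsi ba; have bl := bmeas_trl mu nu bc lambda_gt0 bpsi.
rewrite (iint_l mu nu bc lambda_gt0 ba bl bpsi); apply: eq_int => x.
by rewrite subrr mul0r expR0 mul1r.
Qed.

Lemma iint_gibbs_sink psi b : bmeas psi -> bmeas b ->
  \iint_p (gibbs (trl psi) psi p * b p.2) =
  \int[nu]_y (b y * expR (- ((sink psi y - psi y) / lambda))).
Proof.
move=> bpsi bb; have bl := bmeas_trl mu nu bc lambda_gt0 bpsi.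
rewrite (iint_r mu nu bc lambda_gt0 bb bl bpsi); apply: eq_int => y.
by rewrite -[- (_ / lambda)]mulNr opprB mulrC.
Qed.

Lemma int_mid d (T : measurableType d) (P : probability T R) (f g : T -> R) :
  bmeas f -> bmeas g ->
  \int[P]_x ((f x + g x) / 2) = (\int[P]_x f x + \int[P]_x g x) / 2.
Proof.
move=> bf bg; rewrite -intD// mulrC -intZ; last by bm.
by apply: eq_int => x; rewrite mulrC.
Qed.

(** The integrals of the potentials against [nu] are linear and cancel, so the variance bound is
    expressed by the concavity defect of [E]. *)
Lemma semidual_mid psi0 psi1 : bmeas psi0 -> bmeas psi1 ->
  \int[mu]_x (trl (fun y => (psi0 y + psi1 y) / 2) x - (trl psi0 x + trl psi1 x) / 2)
  = E (fun y => (psi0 y + psi1 y) / 2) - (E psi0 + E psi1) / 2.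
Proof.
move=> b0 b1.
have bpsi : bmeas (fun y => (psi0 y + psi1 y) / 2) by bm.
have bl := bmeas_trl mu nu bc lambda_gt0 bpsi.
have bl0 := bmeas_trl mu nu bc lambda_gt0 b0.
have bl1 := bmeas_trl mu nu bc lambda_gt0 b1.
have mid (f g h : T1 -> R) : bmeas f -> bmeas g -> bmeas h ->
    \int[mu]_x (h x - (f x + g x) / 2) =
    \int[mu]_x h x + (\int[nu]_y psi0 y + \int[nu]_y psi1 y) / 2 -
    (\int[mu]_x f x + \int[nu]_y psi0 y +
     (\int[mu]_x g x + \int[nu]_y psi1 y)) / 2.
  move=> bf bg bh; rewrite intB; [|by bm..]; rewrite int_mid//; lra.
by rewrite (mid _ _ _ bl0 bl1 bl) -(int_mid nu b0 b1).
Qed.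

(* The real arithmetic of [gap_le_gain]: [k], [iv], [v0] and [v1]
   integrate [trl psi1 - trl psi0] against [mu], and [psi1 - psi0] against [nu]
   and the marginals of the Gibbs couplings of [psi0] and [psi1]. *)
Lemma gap_arith (E0 E1 Em G r k iv v0 v1 b2 bq w1 w2 fk eta A : R) :
  A = 8 * lambda + 44 * r -> K <= r ->
  0 < eta -> E0 <= S -> S - eta <= E1 -> E1 <= S -> Em <= S ->
  E1 - E0 = k + iv -> w2 <= (4 * lambda + 3 * K) * w1 -> w1 = k + v1 ->
  k + v0 <= 0 -> iv - v0 <= G / lambda / (2 * A)^-1 + (2 * A)^-1 * b2 ->
  - (iv - v1) <= eta -> b2 - bq <= eta -> bq <= 2 * w2 + 2 * fk ->
  fk <= 38 * r * (Em - (E0 + E1) / 2) ->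
  S - E0 <= (32 + 176 * (r / lambda)) * G + (3 + A^-1) * eta.
Proof.
move=> AE rK; have l0 := lambda_gt0; have K0 := K_ge0.
have A0 : 0 < A by lra.
move=> eta0 E0S E1S E1S' EmS E1E hw2 w1E kv0 hG h1 h2 hbq hfk.
have hw1 : w1 <= S - E0 + eta by lra.
have hw2' : w2 <= (4 * lambda + 3 * K) * (S - E0 + eta).
  by apply: le_trans hw2 _; rewrite ler_wpM2l//; lra.
have hfk' : fk <= 38 * r * ((S - E0 + eta) / 2).
  apply: le_trans hfk _; by rewrite ler_wpM2l//; lra.
(* The coefficient 44 in [A] is 6 + 38: 2 w2 contributes 8 lambda + 6 K, 2 fk contributes 38 r, and
   K <= r. *)
have hb2 : b2 <= eta + A * (S - E0 + eta).
  have : 8 * lambda + 6 * K + 38 * r <= A by lra.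
  have D0 : 0 <= S - E0 + eta by lra.
  move/(ler_wpM2r D0).
  by move: (S - E0 + eta) hw2' hfk' => D; lra.
(* The weight 1 / (2 A) leaves only half of the gap on the right. Absorbing it doubles the gain
   term, and 4 A / lambda = 32 + 176 r / lambda. *)
have hb2' : (2 * A)^-1 * b2 <= (2 * A)^-1 * eta + (S - E0 + eta) / 2.
  apply: (@le_trans _ _ ((2 * A)^-1 * (eta + A * (S - E0 + eta)))).
    by rewrite ler_wpM2l// invr_ge0; lra.
  rewrite mulrDr lerD2l le_eqVlt; apply/orP; left; apply/eqP.
  by field; rewrite gt_eqF.
have hD : S - E0 - eta <= G / lambda * (2 * A) + ((2 * A)^-1 * eta + (S - E0 + eta) / 2).
  by rewrite invrK in hG; lra.
have -> : (32 + 176 * (r / lambda)) * G = 2 * (G / lambda * (2 * A)).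
  by rewrite AE; field; rewrite gt_eqF.
have -> : (3 + A^-1) * eta = 2 * eta + 2 * ((2 * A)^-1 * eta) + eta.
  by field; rewrite gt_eqF.
lra.
Qed.

Lemma bmeas_sink_density psi : bmeas psi ->
  bmeas (fun y => expR (- ((sink psi y - psi y) / lambda))).
Proof. by move=> bpsi; have bs := bmeas_sink mu nu bc lambda_gt0 bpsi; bm. Qed.

Lemma gap_le_gain psi0 : bmeas psi0 -> osc_le psi0 ->
  S - E psi0 <= (32 + 176 * (rho * K / lambda)) * gain psi0.
Proof.
move=> b0 o0.
pose A := 8 * lambda + 44 * (rho * K).
have K0 := K_ge0.
have rK : K <= rho * K by rewrite -{1}(mul1r K) ler_wpM2r.
have A0 : 0 < A by rewrite /A; have := lambda_gt0; lra.
(* This makes the weight 1 / (2 A) admissible for test functions bounded by 2 K. *)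
have AK : 2 * K <= 1 / 4 * (2 * A) by rewrite /A; have := lambda_gt0; lra.
apply/ler_addgt0Pr => e e0.
have A3 : 0 < 3 + A^-1 by rewrite addr_gt0// invr_gt0.
(* [eta] is such that the total error in [gap_arith] is exactly [e]. *)
pose eta := e / (3 + A^-1).
have eta0 : 0 < eta by rewrite divr_gt0.
have -> : e = (3 + A^-1) * eta by rewrite mulrC divfK// gt_eqF.
(* This bound covers both test functions used below, psi1 - psi0 + k and its square. *)
have [psi1 [b1 o1 near dev]] := near_optimal (2 * K + (2 * K) ^+ 2) eta0.
have l0 := bmeas_trl mu nu bc lambda_gt0 b0.
have l1 := bmeas_trl mu nu bc lambda_gt0 b1.
have eqm : \iint_p gibbs (trl psi0) psi0 p = \iint_p gibbs (trl psi1) psi1 p.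
  by rewrite (mass_trl mu nu bc lambda_gt0 b0) (mass_trl mu nu bc lambda_gt0 b1).
have bmid : bmeas (fun y => (psi0 y + psi1 y) / 2) by bm.
have W := trl_diff_bound b0 b1 o0 o1.
have [k0 var] := trl_variance b0 b1 o0 o1.
rewrite (semidual_mid b0 b1) in var.
have Emid := S_ub bmid.
have marg1 a : bmeas a -> \iint_p (gibbs (trl psi0) psi0 p * a p.1) = \int[mu]_x a x.
  exact: iint_gibbs_trl.
have marg1' a : bmeas a -> \iint_p (gibbs (trl psi1) psi1 p * a p.1) = \int[mu]_x a x.
  exact: iint_gibbs_trl.
have [q0 q0E] : exists q, q = fun y => expR (- ((sink psi0 y - psi0 y) / lambda)).
  exact: (ex_intro _ (fun y => expR (- ((sink psi0 y - psi0 y) / lambda))) erefl).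
have [q1 q1E] : exists q, q = fun y => expR (- ((sink psi1 y - psi1 y) / lambda)).
  exact: (ex_intro _ (fun y => expR (- ((sink psi1 y - psi1 y) / lambda))) erefl).
have bq0 : bmeas q0 by rewrite q0E; exact: bmeas_sink_density.
have bq1 : bmeas q1 by rewrite q1E; exact: bmeas_sink_density.
have iq0 : \int[nu]_y q0 y = 1 by rewrite q0E; exact: int_sink_density.
have iq1 : \int[nu]_y q1 y = 1 by rewrite q1E; exact: int_sink_density.
have marg2 b : bmeas b ->
    \iint_p (gibbs (trl psi0) psi0 p * b p.2) = \int[nu]_y (b y * q0 y).
  by rewrite q0E; exact: iint_gibbs_sink.
have marg2' b : bmeas b ->
    \iint_p (gibbs (trl psi1) psi1 p * b p.2) = \int[nu]_y (b y * q1 y).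
  by rewrite q1E; exact: iint_gibbs_sink.
have {}dev b : bmeas b -> (forall y, `|b y| <= 2 * K + (2 * K) ^+ 2) ->
    \int[nu]_y (b y * (1 - q1 y)) <= eta.
  by rewrite q1E; exact: dev.
have mdev b : bmeas b -> (forall y, `|(2 * A)^-1 * b y| <= 1 / 4) ->
    \int[nu]_y (b y * (1 - q0 y)) <=
    gain psi0 / lambda / (2 * A)^-1 + (2 * A)^-1 * \int[nu]_y (b y ^+ 2).
  rewrite q0E => bb; apply: (marginal_deviation b0 bb).
  by rewrite invr_gt0 mulr_gt0.
have E0E : E psi0 = \int[mu]_x trl psi0 x + \int[nu]_y psi0 y by [].
have E1E : E psi1 = \int[mu]_x trl psi1 x + \int[nu]_y psi1 y by [].
have E0S := S_ub b0.
have E1S := S_ub b1.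
move: {q0E q1E bmid} (gain psi0) mdev => G mdev.
move: (E _) (E _) (E _) E0E E1E E0S E1S Emid var near => E0 Em E1.
move: (trl psi0) (trl psi1) l0 l1 eqm W marg1 marg1' marg2 marg2' =>
  phi0 phi1 l0 l1 eqm W marg1 marg1' marg2 marg2' E0E E1E E0S E1S Emid var near.
have bf : bmeas (fun x => phi1 x - phi0 x) by bm.
have bv : bmeas (fun y => psi1 y - psi0 y) by bm.
have gp0 : bmeas (fun p => gibbs phi0 psi0 p) by exact: bmeas_gibbs.
have gp1 : bmeas (fun p => gibbs phi1 psi1 p) by exact: bmeas_gibbs.
(* With this centring, psi1(y) - psi0(y) + k is the mean over x of a quantity bounded by 2 K. *)
pose k := \int[mu]_x (phi1 x - phi0 x).
have bb : bmeas (fun y => psi1 y - psi0 y + k) by bm.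
have bbK y : `|psi1 y - psi0 y + k| <= 2 * K.
  rewrite ler_norml addrC -(int_cst mu (psi1 y - psi0 y)) -intD; [|by bm..].
  apply: int_bounds; first by bm.
  by move=> x; rewrite -ler_norml.
have bbK2 y : `|(psi1 y - psi0 y + k) ^+ 2| <= (2 * K) ^+ 2.
  by rewrite normrX lerXn2r ?nnegrE ?mulr_ge0.
have K2 : 0 <= (2 * K) ^+ 2 by exact: sqr_ge0.
have intvk (q : T2 -> R) : bmeas q -> \int[nu]_y q y = 1 ->
    \int[nu]_y ((psi1 y - psi0 y + k) * (1 - q y)) =
    \int[nu]_y (psi1 y - psi0 y) - \int[nu]_y ((psi1 y - psi0 y) * q y).
  move=> bq iq; rewrite -intB; [|by bm..].
  transitivity (\int[nu]_y (psi1 y - psi0 y - (psi1 y - psi0 y) * q y + k * (1 - q y))).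
    by apply: eq_int => y; ring.
  rewrite intD; [|by bm..]; rewrite (@intZ _ _ _ _ k); last by bm.
  by rewrite [X in _ + k * X]intB ?iq ?int_cst ?subrr ?mulr0 ?addr0//; bm.
have S1 : \iint_p (gibbs phi1 psi1 p * (phi1 p.1 - phi0 p.1 + (psi1 p.2 - psi0 p.2))) =
    k + \int[nu]_y ((psi1 y - psi0 y) * q1 y).
  rewrite -marg2'// /k -marg1'// -iintD; [|by bm..].
  by congr Rintegral; apply/funext => p; rewrite mulrDr.
(* Gibbs' inequality for the coupling of [psi0] relative to that of [psi1]: this is the nonpositive
   term dropped from the gap. *)
have S0 : k + \int[nu]_y ((psi1 y - psi0 y) * q0 y) <= 0.
  rewrite -marg2// /k -marg1// -iintD; [|by bm..].
  have := gibbs_inequality bc lambda_gt0 l1 b1 l0 b0 (esym eqm).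
  rewrite -oppr_le0; apply: le_trans; rewrite -mulN1r -iintZ; last by bm.
  by apply: le_iint; [by bm|by bm|move=> p]; rewrite -!mulrDr mulrCA; apply: ler_wpM2l; [exact: expR_ge0|lra].
(* Replacing [nu] by the second marginal of the nearly optimal coupling costs at most [eta]. *)
have h2 : \int[nu]_y ((psi1 y - psi0 y + k) ^+ 2) -
    \int[nu]_y ((psi1 y - psi0 y + k) ^+ 2 * q1 y) <= eta.
  rewrite -intB; [|by bm..].
  apply: le_trans (dev _ _ _); last 2 first.
  - by have := bmeasX 2 bb; exact.
  - by move=> y /=; rewrite (le_trans (bbK2 y))// lerDr mulr_ge0.
  by apply: le_int; [by bm|by bm|move=> y]; rewrite mulrBr mulr1.
have h1 : - (\int[nu]_y (psi1 y - psi0 y) -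
    \int[nu]_y ((psi1 y - psi0 y) * q1 y)) <= eta.
  rewrite -intvk// -mulN1r -intZ; last by bm.
  apply: le_trans (dev _ (bmeasN bb) _); last first.
    by move=> y /=; rewrite normrN (le_trans (bbK y))// lerDl.
  by apply: le_int; [by bm|by bm|move=> y]; rewrite mulN1r mulNr.
apply: (@gap_arith _ _ _ G _ k _ _ _ _ _ _ _ _ _ A) (erefl A) rK eta0 E0S near E1S Emid _
  (weighted_sqr_le l0 b0 l1 b1 eqm W) S1 S0 _ h1 h2
  (_ : _ <= 2 * _ + 2 * \int[mu]_x (phi1 x - phi0 x - k) ^+ 2) _.
- by rewrite E0E E1E /k !intB//; move: (\int[mu]_x _) => *; ring.
- rewrite -intvk//; apply: mdev => // y.
  have iA : 0 <= (2 * A)^-1 by rewrite invr_ge0 mulr_ge0// ltW.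
  rewrite normrM (ger0_norm iA) mulrC ler_pdivrMr ?mulr_gt0//; apply: le_trans (bbK y) _.
  exact: AK.
- rewrite -marg1'; last by bm.
  rewrite -marg2'; last by bm.
  exact: (weighted_shift_le k l0 b0 l1 b1).
(* The variance bound holds for some constant [k0]; the mean [k] does at least as well. *)
- apply: le_trans (int_sqr_mean_le k0 bf) _.
  by rewrite (mulrA 38).
Qed.

(** The gap estimate is applied after the step, where the oscillation is at most [K]; the gain there
    is bounded by the gain at [psi], hence by the increase of [E]. Passing from the new gap to the
    old one adds one such increase, whence 33 = 32 + 1. *)
Lemma semidual_sink_contraction psi alpha : bmeas psi ->
  33 + 176 * (rho * K / lambda) <= alpha ->
  S - E (sink psi) <= (S - E psi) * (1 - alpha^-1).
Proof.
move=> bpsi; set a := rho * K / lambda => ha.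
have a0 : 0 <= a.
  have := rho_ge1 => r1.
  rewrite divr_ge0//; last exact: ltW.
  by rewrite mulr_ge0//; exact: le_trans ler01 r1.
have bs := bmeas_sink mu nu bc lambda_gt0 bpsi.
have h1 := gap_le_gain bs (osc_sink bpsi).
rewrite -/a in h1.
have h2 := sink_gain_sink mu nu bc lambda_gt0 bpsi.
have h3 := semidual_sink mu nu bc lambda_gt0 bpsi.
have h4 := S_ub bpsi.
move: (gain (sink psi)) (gain psi) (E (sink psi)) (E psi) h1 h2 h3 h4.
move=> g1 g0 E1 E0 h1 h2 h3 h4.
have h5 : S - E1 <= (32 + 176 * a) * (E1 - E0).
  by apply: le_trans h1 _; rewrite ler_wpM2l//; lra.
have al0 : 0 < alpha by lra.
rewrite mulrBr mulr1 lerBrDr -lerBrDl ler_pdivrMr//.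
have -> : S - E0 - (S - E1) = E1 - E0 by ring.
have h6 : S - E0 <= (33 + 176 * a) * (E1 - E0) by lra.
apply: le_trans h6 _; rewrite mulrC ler_wpM2l//.
by rewrite -(pmulr_rge0 (E1 - E0) (_ : 0 < 33 + 176 * a)); lra.
Qed.

End gap_estimate.

(** * The Prekopa-Leindler inequality *)

Section lebesgue_line.
Context {R : realType}.
Local Notation leb := (@lebesgue_measure R).

(** The preimage of a set [A] is the midpoint set (A + t) / 2. *)
Definition dilate (t : R) : measurableTypeR R -> measurableTypeR R :=
  fun z => 2 * z - t.

Lemma measurable_dilate t : measurable_fun setT (dilate t).
Proof.
have h : measurable_fun [set: R] (fun z : R => 2 * z - t).
  by apply: measurable_funB => //; exact: measurable_funM.
exact: h.
Qed.

(** The left side is a measure in [A] that agrees with Lebesgue measure on half-open intervals. *)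
Lemma lebesgue_measure_dilate (t : R) (A : set (measurableTypeR R)) : measurable A ->
  (2%:E * leb (dilate t @^-1` A))%E = leb A.
Proof.
move=> mA; apply/esym.
pose m : {measure set (measurableTypeR R) -> \bar R} :=
  mscale (NngNum (ler0n R 2))
    (measure_function_pushforward__canonical__measure_function_Measure
       leb (measurable_dilate t)).
have mE B : m B = (2%:E * leb (dilate t @^-1` B))%E by [].
rewrite -mE; apply: (@lebesgue_measure_unique R m) => // _ [[a b] /= _ <-].
rewrite mE.
rewrite (_ : _ @^-1` _ = `](a + t) / 2, (b + t) / 2]%classic).
  rewrite !lebesgue_measure_itv/= !lte_fin ltr_pM2r// ltrD2r.
  case: ifPn => _; last by rewrite mule0.
  by rewrite -!EFinB -EFinM; congr EFin; lra.
apply/seteqP; split => z /=; rewrite !in_itv/= /dilate => /andP[h1 h2];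
  by apply/andP; split; lra.
Qed.

(* One-dimensional Brunn-Minkowski: up to a small part of [A] near its supremum
   and of [B] near its infimum, [(A + b) / 2] and [(a + B) / 2] are disjoint. *)
Lemma brunn_minkowski1 (A B C : set R) (r : R) :
  measurable A -> measurable B -> measurable C -> A !=set0 -> B !=set0 ->
  (forall x, A x -> `|x| <= r) -> (forall x, B x -> `|x| <= r) ->
  (forall x y, A x -> B y -> C ((x + y) / 2)) ->
  (leb A + leb B <= 2%:E * leb C)%E.
Proof.
move=> mA mB mC A0 B0 Ar Br ABC.
apply/lee_addgt0Pr => e e0.
have supA : has_sup A.
  by split=> //; exists r => x /Ar; rewrite ler_norml => /andP[].
have infB : has_inf B.
  by split=> //; exists (- r) => x /Br; rewrite ler_norml => /andP[].
have e20 : 0 < e / 2 by rewrite divr_gt0.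
have [a Aa sa] := sup_adherent e20 supA.
have [b Bb ib] := inf_adherent e20 infB.
have mlt : measurable (`]-oo, a[%classic : set R) by exact: measurable_itv.
have mgt : measurable (`]b, +oo[%classic : set R) by exact: measurable_itv.
(* The part of [A] cut off lies in [[a, sup A]], of length at most e / 2; likewise for [B] below. *)
have leA : (leb A <= leb (A `&` `]-oo, a[) + (e / 2)%:E)%E.
  rewrite -[X in (leb X <= _)%E](setUIDK A `]-oo, a[%classic).
  apply: le_trans (measureU2 _ _ _) _; [exact: measurableI|exact: measurableD|].
  rewrite leeD2l//.
  apply: (@le_trans _ _ (leb `[a, sup A])).
    apply: le_measure; rewrite ?inE; [exact: measurableD|exact: measurable_itv|].
    move=> x [Ax /=]; rewrite in_itv/= => /negP; rewrite -leNgt => ax.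
    by rewrite in_itv/= ax/=; exact: sup_upper_bound.
  rewrite lebesgue_measure_itv/= lte_fin; case: ifPn => _; last by rewrite lee_fin ltW.
  by rewrite -EFinB lee_fin; lra.
have leB : (leb B <= leb (B `&` `]b, +oo[) + (e / 2)%:E)%E.
  rewrite -[X in (leb X <= _)%E](setUIDK B `]b, +oo[%classic).
  apply: le_trans (measureU2 _ _ _) _; [exact: measurableI|exact: measurableD|].
  rewrite leeD2l//.
  apply: (@le_trans _ _ (leb `[inf B, b])).
    apply: le_measure; rewrite ?inE; [exact: measurableD|exact: measurable_itv|].
    move=> x [Bx /=]; rewrite in_itv/= andbT => /negP; rewrite -leNgt => ax.
    by rewrite in_itv/= ax andbT; exact: (ge_inf infB.2).
  rewrite lebesgue_measure_itv/= lte_fin; case: ifPn => _; last by rewrite lee_fin ltW.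
  by rewrite -EFinB lee_fin; lra.
set A' := (A `&` `]-oo, a[) in leA; set B' := (B `&` `]b, +oo[) in leB.
have mA' : measurable A' by exact: measurableI.
have mB' : measurable B' by exact: measurableI.
have mdA : measurable (dilate b @^-1` A').
  by rewrite -[X in measurable X]setTI; exact: measurable_dilate.
have mdB : measurable (dilate a @^-1` B').
  by rewrite -[X in measurable X]setTI; exact: measurable_dilate.
have : (leb A' + leb B' <= 2%:E * leb C)%E.
  rewrite -(lebesgue_measure_dilate b mA') -(lebesgue_measure_dilate a mB').
  (* A common point z would satisfy both 2 z < a + b and 2 z > a + b. *)
  rewrite -muleDr// ?ge0_adde_def ?inE// lee_pmul2l// -measureU//; last first.
    apply/seteqP; split => // z [] /=; rewrite /A' /B' /dilate /=.
    by move=> [_]; rewrite /= in_itv/= => h1 [_]; rewrite /= in_itv/= andbT => h2; lra.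
  apply: le_measure; rewrite ?inE//; first exact: measurableU.
  move=> z [[Az _]|[Bz _]].
    have -> : z = (dilate b z + b) / 2 by rewrite /dilate; lra.
    exact: ABC.
  have -> : z = (a + dilate a z) / 2 by rewrite /dilate; lra.
  exact: ABC.
move=> h; apply: le_trans (leeD leA leB) _.
rewrite addeACA -EFinD -splitr leeD2r//.
Qed.

Lemma measurable_lt_set d (T : measurableType d) (u v : T -> R) :
  measurable_fun setT u -> measurable_fun setT v -> measurable [set x | u x < v x].
Proof.
move=> mu mv; rewrite -[X in measurable X]setTI.
by have /(_ measurableT [set true]) := measurable_fun_ltr mu mv; exact.
Qed.

Definition subgraph (f : R -> R) : set (R * R) :=
  [set p | 0 <= p.2] `&` [set p | p.2 < f p.1].

Definition level (f : R -> R) (t : R) : set R := [set x | 0 <= t /\ t < f x].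

Lemma measurable_subgraph (f : R -> R) : measurable_fun setT f -> measurable (subgraph f).
Proof.
move=> mf; apply: measurableI; rewrite -[X in measurable X]setTI.
  exact: measurable_fun_le.
rewrite setTI; apply: measurable_lt_set => //.
exact: (measurableT_comp mf measurable_fst).
Qed.

Lemma ysection_subgraph (f : R -> R) (t : R) :
  ysection (subgraph f) t = level f t.
Proof. by apply/seteqP; split => x; rewrite /ysection /= in_setE. Qed.

Lemma measurable_layer (f : R -> R) : measurable_fun setT f ->
  measurable_fun setT (fun t : R => leb (level f t)).
Proof.
move=> /measurable_subgraph mG.
under eq_fun do rewrite -ysection_subgraph.
exact: measurable_fun_ysection.
Qed.

(* [level f t] is empty for [t < 0], so the right-hand integral is over [t >= 0]. *)
Lemma layer_cake (f : R -> R) : measurable_fun setT f -> (forall x, 0 <= f x) ->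
  (\int[leb]_x (f x)%:E = \int[leb]_t leb (level f t))%E.
Proof.
move=> mf f0.
have mG := measurable_subgraph mf; set G := subgraph f in mG.
(* Tonelli for the subgraph: its vertical sections have length [f x], its horizontal ones are the
   level sets. *)
have := indic_fubini_tonelli leb leb mG.
rewrite indic_fubini_tonelli_FE// indic_fubini_tonelli_GE// => FG.
transitivity (\int[leb]_x (leb \o xsection G) x)%E.
  apply: eq_integral => x _ /=.
  rewrite (_ : xsection G x = `[0, f x[%classic).
    rewrite lebesgue_measure_itv/= lte_fin sube0.
    by case: ltP => // fx0; congr EFin; apply/eqP; rewrite eq_le fx0 f0.
  by apply/seteqP; split => t; rewrite /xsection /= in_setE /G /subgraph /= in_itv/=;
    [move=> [-> ->]|move=> /andP[-> ->]].
rewrite FG; apply: eq_integral => t _ /=; by rewrite ysection_subgraph.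
Qed.

(** Bounded support and bounded values keep all integrals finite; slicing the functions that are
    [tame] in higher dimension leads back to this class. *)
Definition tame1 (f : R -> R) := measurable_fun setT f /\
  exists B r : R, forall x, 0 <= f x <= B /\ (r < `|x| -> f x = 0).

(** When [f] and [g] both have supremum 1, their level sets are nonempty for the same heights t < 1.
    Brunn-Minkowski at each height, integrated over t, gives an additive bound. *)
Lemma prekopa_leindler1_unit (f g h : R -> R) (r : R) :
  measurable_fun setT f -> measurable_fun setT g -> measurable_fun setT h ->
  (forall x, 0 <= f x <= 1) -> (forall x, 0 <= g x <= 1) -> (forall x, 0 <= h x) ->
  (forall x, r < `|x| -> f x = 0) -> (forall x, r < `|x| -> g x = 0) ->
  (forall t, t < 1 -> exists x, t < f x) -> (forall t, t < 1 -> exists x, t < g x) ->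
  (forall t x y, 0 <= t -> t < f x -> t < g y -> t < h ((x + y) / 2)) ->
  (\int[leb]_x (f x)%:E + \int[leb]_x (g x)%:E <= 2%:E * \int[leb]_x (h x)%:E)%E.
Proof.
move=> mf mg mh f01 g01 h0 fr gr sf sg fgh.
have f0 x : 0 <= f x by case/andP: (f01 x).
have g0 x : 0 <= g x by case/andP: (g01 x).
rewrite (layer_cake mf f0) (layer_cake mg g0) (layer_cake mh h0).
rewrite -ge0_integralD//; [|exact: measurable_layer..].
rewrite -ge0_integralZl//; last exact: measurable_layer.
apply: ge0_le_integral => //.
- by move=> t _; rewrite adde_ge0.
- by apply: emeasurable_funD; exact: measurable_layer.
- by apply: emeasurable_funM => //; exact: measurable_layer.
move=> t _; have [t0|t0] := leP 0 t; last first.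
  have e0 (u : R -> R) : level u t = set0.
    by apply/seteqP; split => // x /= [/le_lt_trans/(_ t0)]; rewrite ltxx.
  by rewrite !e0 measure0 adde0 mule0.
have [t1|t1] := ltP t 1; last first.
  have e0 (u : R -> R) : (forall x, 0 <= u x <= 1) -> level u t = set0.
    move=> u1; apply/seteqP; split => // x /= [_ tu].
    by have /andP[_ /(lt_le_trans tu)] := u1 x; rewrite ltNge t1.
  by rewrite (e0 f)// (e0 g)// measure0 adde0 mule_ge0.
have mset (u : R -> R) : measurable_fun setT u -> measurable (level u t).
  move=> mu; rewrite (_ : level u t = [set x | cst t x < u x]).
    exact: measurable_lt_set.
  by apply/seteqP; split => x /=; [case|].
apply: (@brunn_minkowski1 _ _ _ r); try exact: mset.
- by have [x tx] := sf t t1; exists x.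
- by have [x tx] := sg t t1; exists x.
- by move=> x /= [_ tx]; rewrite leNgt; apply/negP => /fr fx0; rewrite fx0 ltNge t0 in tx.
- by move=> x /= [_ tx]; rewrite leNgt; apply/negP => /gr fx0; rewrite fx0 ltNge t0 in tx.
- by move=> x y /= [_ tx] [_ ty]; split => //; exact: fgh.
Qed.

Lemma integrable_bounded_support d (T : measurableType d)
    (m : {measure set T -> \bar R}) (D : set T) (f : T -> R) (B : R) :
  measurable D -> (m D < +oo)%E -> measurable_fun setT f ->
  (forall x, `|f x| <= B) -> (forall x, ~ D x -> f x = 0) ->
  m.-integrable setT (EFin \o f).
Proof.
move=> mD mDoo mf fB f0.
have -> : EFin \o f = (EFin \o f) \_ D.
  apply/funext => x; rewrite patchE; case: ifPn => // /negP xD.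
  by rewrite /= f0// => Dx; apply: xD; rewrite inE.
apply/(integrable_mkcond _ mD); apply: measurable_bounded_integrable => //.
  exact: measurable_funS mf.
exists B; split; first exact: num_real.
by move=> x Bx y _ /=; exact: le_trans (fB y) (ltW Bx).
Qed.

Lemma tame1_integrable f : tame1 f -> leb.-integrable setT (EFin \o f).
Proof.
move=> [mf [B [r fBr]]].
pose D : set (measurableTypeR R) := `[- r, r]%classic.
have mD : measurable D by exact: measurable_itv.
have lt_itv : (leb D < +oo)%E.
  rewrite lebesgue_measure_itv/=; case: ifPn => _; last exact: ltry.
  by rewrite -EFinB ltry.
apply: (@integrable_bounded_support _ _ leb D f B) => //.
- by move=> x; have [/andP[f0 fB] _] := fBr x; rewrite ger0_norm.
- move=> x /= xr; apply: (fBr x).2; rewrite ltNge; apply/negP => xr'.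
  by apply: xr; rewrite /D /= in_itv/= -ler_norml.
Qed.

(** Dividing [f] and [g] by their suprema and [h] by the geometric mean of these reduces to the
    additive bound, and the product is recovered by the arithmetic-geometric inequality. If a
    supremum is 0, so is the corresponding integral. *)
Lemma prekopa_leindler1 (f g h : R -> R) : tame1 f -> tame1 g -> tame1 h ->
  (forall x y, f x * g y <= h ((x + y) / 2) ^+ 2) ->
  (\int[leb]_x f x) * (\int[leb]_x g x) <= (\int[leb]_x h x) ^+ 2.
Proof.
move=> tf tg th fgh.
have [f_if g_ig h_ih] := And3 (tame1_integrable tf) (tame1_integrable tg) (tame1_integrable th).
have nneg u : tame1 u -> forall x, 0 <= u x.
  by move=> [_ [B [r uBr]]] x; have [/andP[]] := uBr x.
have f0 := nneg _ tf; have g0 := nneg _ tg; have h0 := nneg _ th.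
have sup_range u : tame1 u -> has_sup (range u).
  move=> [_ [B [r uBr]]]; split; first by exists (u 0), 0.
  by exists B => _ [x _ <-]; have [/andP[]] := uBr x.
have le_sup u x : tame1 u -> u x <= sup (range u).
  by move=> tu; apply: sup_upper_bound; [exact: sup_range|exists x].
have sup0 u : tame1 u -> ~~ (0 < sup (range u)) -> \int[leb]_x u x = 0.
  move=> tu; rewrite -leNgt => s0.
  transitivity (\int[leb]_x (0 : R)); last by rewrite Rintegral_cst// mul0r.
  apply: eq_Rintegral => x _; apply/eqP; rewrite eq_le (nneg _ tu) andbT.
  exact: le_trans (le_sup _ _ tu) s0.
have [sf0|/(sup0 _ tf) ->] := boolP (0 < sup (range f)); last first.
  by rewrite mul0r sqr_ge0.
have [sg0|/(sup0 _ tg) ->] := boolP (0 < sup (range g)); last first.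
  by rewrite mulr0 sqr_ge0.
set sf := sup (range f) in sf0; set sg := sup (range g) in sg0.
pose m := Num.sqrt (sf * sg).
have m0 : 0 < m by rewrite sqrtr_gt0 mulr_gt0.
have m2 : m ^+ 2 = sf * sg by rewrite sqr_sqrtr// mulr_ge0// ltW.
have [mf [Bf [rf fBr]]] := tf; have [mg [Bg [rg gBr]]] := tg.
have mh := th.1.
have unit u s x : tame1 u -> s = sup (range u) -> 0 < s -> 0 <= u x / s <= 1.
  move=> tu -> s0; rewrite divr_ge0 ?(nneg _ tu) ?(ltW s0)//=.
  by rewrite ler_pdivrMr// mul1r le_sup.
have near_sup u s t : tame1 u -> s = sup (range u) -> 0 < s -> t < 1 ->
    exists x, t < u x / s.
  move=> tu sE s0 t1.
  have t10 : 0 < 1 - t by rewrite subr_gt0.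
  have [_ [x _ <-] hx] := sup_adherent (mulr_gt0 s0 t10) (sup_range _ tu).
  by exists x; rewrite ltr_pdivlMr//; rewrite -sE in hx; lra.
have : (\int[leb]_x (f x / sf)%:E + \int[leb]_x (g x / sg)%:E <=
    2%:E * \int[leb]_x (h x / m)%:E)%E.
  apply: (@prekopa_leindler1_unit _ _ _ (Num.max rf rg)).
  - exact: measurable_funM.
  - exact: measurable_funM.
  - exact: measurable_funM.
  - by move=> x; exact: unit.
  - by move=> x; exact: unit.
  - by move=> x; rewrite divr_ge0// ltW.
  - by move=> x; rewrite gt_max => /andP[xr _]; rewrite (fBr x).2// mul0r.
  - by move=> x; rewrite gt_max => /andP[_ xr]; rewrite (gBr x).2// mul0r.
  - by move=> t; exact: near_sup.
  - by move=> t; exact: near_sup.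
  - move=> t x y t0; rewrite !ltr_pdivlMr// => tf' tg'.
    have tm0 : 0 <= t * m by rewrite mulr_ge0// ltW.
    rewrite -(ltr_pXn2r (n := 2))// ?nnegrE//.
    apply: lt_le_trans (fgh x y); rewrite exprMn m2.
    have -> : t ^+ 2 * (sf * sg) = t * sf * (t * sg) by ring.
    by rewrite ltr_pM// mulr_ge0// ltW.
have scale u s : leb.-integrable setT (EFin \o u) ->
    (\int[leb]_x (u x / s)%:E)%E = ((\int[leb]_x u x) / s)%:E.
  move=> iu; rewrite -RintegralZr// /Rintegral fineK//.
  apply: integrable_fin_num => //.
  by have := integrableZr measurableT s^-1 iu; exact.
rewrite !scale// -EFinD -EFinM lee_fin.
set If := \int[leb]_x f x; set Ig := \int[leb]_x g x; set Ih := \int[leb]_x h x => hI.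
have If0 : 0 <= If / sf by rewrite divr_ge0 ?(ltW sf0)// Rintegral_ge0.
have Ig0 : 0 <= Ig / sg by rewrite divr_ge0 ?(ltW sg0)// Rintegral_ge0.
have -> : If * Ig = m ^+ 2 * ((If / sf) * (Ig / sg)).
  by rewrite m2; field; rewrite !gt_eqF.
have -> : Ih = m * (Ih / m) by rewrite mulrCA divff ?gt_eqF// mulr1.
rewrite exprMn ler_pM2l ?exprn_gt0//.
move: (If / sf) (Ig / sg) (Ih / m) If0 Ig0 hI => a b c a0 b0 abc.
apply: (@le_trans _ _ (((a + b) / 2) ^+ 2)).
  by have := sqr_ge0 (a - b); rewrite !expr2; lra.
by rewrite lerXn2r ?nnegrE//; lra.
Qed.

End lebesgue_line.

Section prekopa_leindler.
Context {R : realType}.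
Local Notation leb := (@lebesgue_measure R).

Definition tame n (f : 'rV[R]_n -> R) := measurable_fun setT f /\
  exists B r : R, forall x : 'rV[R]_n, 0 <= f x <= B /\ ((exists i, r < `|x 0 i|) -> f x = 0).

Definition box n (r : R) : set 'rV[R]_n := [set v | forall j, v 0 j \in `[- r, r]].

Arguments box n r _ : clear implicits.

Lemma measurable_box n r : measurable (box n r).
Proof.
have -> : box n r = \bigcap_(j in [set: 'I_n])
    ((fun v : 'rV[R]_n => v 0 j) @^-1` `[- r, r]).
  by apply/seteqP; split=> v /= h j => [_|]; [exact: h|exact: (h j)].
apply: fin_bigcap_measurable => // j _; rewrite -[X in measurable X]setTI.
exact: measurable_coord_rV.
Qed.

Lemma box_lty n r : (lebesgue_rV n (box n r) < +oo)%E.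
Proof.
have -> : box n r = [set v | forall j, `[- r, r]%classic (v 0 j)] by [].
rewrite (@lebesgue_rV_prod R n (fun=> `[- r, r]%classic)); last first.
  by move=> _; exact: measurable_itv.
rewrite ltey_eq; apply/orP; left.
elim/big_ind : _ => // [x y|j _]; first exact: fin_numM.
by rewrite lebesgue_measure_itv/=; case: ifPn.
Qed.

Lemma tame_off_box n (f : 'rV[R]_n -> R) (r : R) :
  (forall x : 'rV[R]_n, (exists i, r < `|x 0 i|) -> f x = 0) ->
  forall x, ~ box n r x -> f x = 0.
Proof.
move=> fr x /existsNP[j /negP]; rewrite in_itv/= -ler_norml -ltNge => rj.
by apply: fr; exists j.
Qed.

Lemma tame_integrable n (f : 'rV[R]_n -> R) : tame f ->
  (lebesgue_rV n).-integrable setT (EFin \o f).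
Proof.
move=> [mf [B [r fBr]]].
apply: (@integrable_bounded_support _ _ _ _ (box n r) f B) => //.
- exact: measurable_box.
- exact: box_lty.
- by move=> x; have [/andP[f0 fB] _] := fBr x; rewrite ger0_norm.
- by apply: tame_off_box => x; case: (fBr x).
Qed.

Section slice.
Variables (n : nat) (f : 'rV[R]_n.+1 -> R).
Hypothesis tf : tame f.

Definition slice (s : R) := \int[lebesgue_rV n]_v f (cons_rV (s, v)).

Let f0 x : 0 <= f x.
Proof. by have [_ [B [r fBr]]] := tf; have [/andP[]] := fBr x. Qed.

Let mfc : measurable_fun setT (fun p : R * 'rV[R]_n => (f (cons_rV p))%:E).
Proof.
apply/measurable_EFinP.
exact: (measurableT_comp tf.1 (@measurable_cons_rV R n)).
Qed.

Lemma tame_slice s : tame (fun v => f (cons_rV (s, v))).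
Proof.
have [mf [B [r fBr]]] := tf; split.
  apply: (measurableT_comp mf).
  exact: (measurableT_comp (@measurable_cons_rV R n) (pair1_measurable s)).
exists B, r => v; split; first by have [] := fBr (cons_rV (s, v)).
move=> [i ri]; apply: (fBr _).2; exists (lift 0 i).
by rewrite cons_rVS.
Qed.

Lemma EFin_slice s : (slice s)%:E = (\int[lebesgue_rV n]_v (f (cons_rV (s, v)))%:E)%E.
Proof.
rewrite /slice /Rintegral fineK//; apply: integrable_fin_num => //.
exact: tame_integrable (tame_slice s).
Qed.

Lemma integral_slice : (\int[lebesgue_rV n.+1]_x (f x)%:E = \int[leb]_s (slice s)%:E)%E.
Proof.
have mf := tf.1.
rewrite /= /lebesgue_rV_step ge0_integral_pushforward//=; last first.
- by move=> x _; rewrite lee_fin.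
- exact/measurable_EFinP.
- exact: measurable_cons_rV.
rewrite preimage_setT fubini_tonelli1//.
  by apply: eq_integral => s _; rewrite EFin_slice.
by move=> x; rewrite lee_fin.
Qed.

(** The slice integrals are bounded by [B] times the volume of the box containing all slice
    supports. *)
Lemma tame1_slice : tame1 slice.
Proof.
have [mf [B [r fBr]]] := tf; split.
  have nn (p : R * 'rV[R]_n) : (0 <= (f (cons_rV p))%:E)%E by rewrite lee_fin.
  have h := measurable_fun_fubini_tonelli_F (m2 := lebesgue_rV n) _ mfc nn.
  exact: (measurableT_comp (fine_measurable measurableT) h).
exists (B * fine (lebesgue_rV n (box n r))), r => s; split.
  apply/andP; split; first by apply: Rintegral_ge0 => v _; exact: f0 (cons_rV (s, v)).
  have ib : (lebesgue_rV n).-integrable setT (EFin \o (\1_(box n r) : 'rV[R]_n -> R)).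
    apply: (@integrable_bounded_support _ _ _ _ (box n r) _ 1) => //.
    - exact: measurable_box.
    - exact: box_lty.
    - by apply: measurable_indic; exact: (@measurable_box n r).
    - by move=> x; rewrite indicE; case: (_ \in _); rewrite ?normr1 ?normr0.
    - by move=> x xb; rewrite indicE memNset.
  have -> : fine (lebesgue_rV n (box n r)) = \int[lebesgue_rV n]_v \1_(box n r) v.
    by rewrite /Rintegral integral_indic ?setIT//; exact: measurable_box.
  rewrite -RintegralZl//; apply: le_Rintegral => //.
  - exact: tame_integrable (tame_slice s).
  - by have := integrableZl measurableT B ib; exact.
  - move=> v _; rewrite indicE; have [vb|vb] := boolP (v \in box n r).
      by rewrite mulr1; have [/andP[]] := fBr (cons_rV (s, v)).
    rewrite mulr0 le_eqVlt; apply/orP; left; apply/eqP.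
    apply: (@tame_off_box n (fun v => f (cons_rV (s, v))) r) => [x [i ri]|]; last by rewrite notin_setE in vb.
    by apply: (fBr _).2; exists (lift 0 i); rewrite cons_rVS.
move=> rs; rewrite /slice; transitivity (\int[lebesgue_rV n]_v (0 : R)); last first.
  by rewrite Rintegral_cst// mul0r.
apply: eq_Rintegral => v _; apply: (fBr _).2; exists ord0.
by rewrite (cons_rV0 (s, v)).
Qed.

End slice.

Lemma cons_rV_mid n s t (v w : 'rV[R]_n) :
  cons_rV ((s + t) / 2, 2^-1 *: (v + w)) =
  2^-1 *: (cons_rV (s, v) + cons_rV (t, w)).
Proof.
apply/rowP => j; rewrite !mxE; case: unliftP => [k|] _ /=; last by rewrite mulrC.
by rewrite !mxE.
Qed.

(** Induction on the dimension: the induction hypothesis on the slices at s, t and (s + t) / 2 is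
    the hypothesis of the one-dimensional inequality for the slice integrals. In dimension 0 the
    measure is a Dirac mass. *)
Theorem prekopa_leindler n (f g h : 'rV[R]_n -> R) :
  tame f -> tame g -> tame h ->
  (forall x y, f x * g y <= h (2^-1 *: (x + y)) ^+ 2) ->
  (\int[lebesgue_rV n]_x f x) * (\int[lebesgue_rV n]_x g x) <=
  (\int[lebesgue_rV n]_x h x) ^+ 2.
Proof.
elim: n f g h => [|n IH] f g h tf tg th fgh.
  have int0 u : tame u -> \int[lebesgue_rV 0]_x u x = u 0.
    move=> tu; rewrite /Rintegral /= integral_dirac//; last first.
      by have [mu _] := tu; exact/measurable_EFinP.
    by rewrite diracT mul1e.
  rewrite !int0//; have := fgh 0 0.
  by rewrite (_ : 2^-1 *: _ = 0)//; apply/rowP => -[].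
have slE u : tame u -> \int[lebesgue_rV n.+1]_x u x = \int[leb]_s slice u s.
  by move=> tu; rewrite /Rintegral integral_slice.
rewrite !slE//; apply: prekopa_leindler1; try exact: tame1_slice.
move=> s t; apply: IH; try exact: tame_slice.
by move=> v w; rewrite cons_rV_mid; exact: fgh.
Qed.

End prekopa_leindler.

(** * The variance bound *)

Section cosh_bound.
Context {R : realType}.

Lemma expR_ge_quadratic (x : R) : 0 <= x -> 1 + x + x ^+ 2 / 2 <= expR x.
Proof.
move=> x0.
have nd : nondecreasing_seq (series (exp_coeff x)).
  by apply: nondecreasing_series => n _ _; rewrite divr_ge0// exprn_ge0.
have /(_ 3) := nondecreasing_cvgn_le nd (is_cvg_series_exp_coeff x).
rewrite /series /= !big_nat_recr//= big_nil /exp_coeff /= expr0 expr1 !divr1.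
by rewrite add0r.
Qed.

(** Squaring E - s >= 1 + s^2 / 2 for E = exp(s) gives E^2 - 2 s E >= 1; dividing by E concludes. *)
Lemma sinh_ge (s : R) : 0 <= s -> 2 * s <= expR s - expR (- s).
Proof.
move=> s0; have h := expR_ge_quadratic s0.
rewrite expRN; set E := expR s in h *.
have E0 : 0 < E := expR_gt0 s.
have s2 := sqr_ge0 s.
rewrite -(ler_pM2r E0) mulrBl mulVf ?gt_eqF//.
have : (1 + s ^+ 2 / 2) ^+ 2 <= (E - s) ^+ 2.
  by rewrite lerXn2r ?nnegrE//; lra.
have -> : (E - s) ^+ 2 = E * E - 2 * s * E + s ^+ 2 by ring.
have -> : (1 + s ^+ 2 / 2) ^+ 2 = 1 + s ^+ 2 + s ^+ 2 * s ^+ 2 / 4 by field.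
have : 0 <= s ^+ 2 * s ^+ 2 by exact: mulr_ge0.
lra.
Qed.

(** exp(t) + exp(-t) - 2 is the square of exp(t/2) - exp(-t/2), which is at least t for t >= 0. *)
Lemma cosh_ge (t : R) : 2 + t ^+ 2 <= expR t + expR (- t).
Proof.
wlog t0 : t / 0 <= t => [h|].
  have [/h//|t0] := leP 0 t.
  by have := h (- t); rewrite sqrrN opprK => h'; rewrite [leRHS]addrC h'//; lra.
have t20 : 0 <= t / 2 by lra.
have : (2 * (t / 2)) ^+ 2 <= (expR (t / 2) - expR (- (t / 2))) ^+ 2.
  have h := sinh_ge t20.
  by rewrite lerXn2r ?nnegrE//; lra.
have e1 : expR t = expR (t / 2) * expR (t / 2) by rewrite -expRD -splitr.
have e2 : expR (- t) = expR (- (t / 2)) * expR (- (t / 2)).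
  by rewrite -expRD -opprD -splitr.
have e3 : expR (t / 2) * expR (- (t / 2)) = 1 by rewrite -expRD subrr expR0.
rewrite mulrC divfK// e1 e2.
have -> : (expR (t / 2) - expR (- (t / 2))) ^+ 2 =
  expR (t / 2) * expR (t / 2) + expR (- (t / 2)) * expR (- (t / 2)) -
  2 * (expR (t / 2) * expR (- (t / 2))) by ring.
rewrite e3; lra.
Qed.

Lemma expR_le_linear (y : R) : 0 <= y -> y <= 1 / 4 -> expR y <= 1 + 4 / 3 * y.
Proof.
move=> y0 y1; have h := expR_ge1Dx (- y).
have e0 := expR_gt0 y.
rewrite expRN in h.
have h1 : expR y * (1 - y) <= 1.
  by rewrite -(ler_pM2l e0) mulfV ?gt_eqF// in h.
rewrite -(ler_pM2r (_ : 0 < 1 - y)); last by lra.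
apply: le_trans h1 _; have := sqr_ge0 y; rewrite expr2; nra.
Qed.

Lemma expR_half_le : expR (2^-1) <= 16 / 9 :> R.
Proof.
have -> : (2^-1 : R) = 4^-1 + 4^-1 by lra.
have h : expR (4^-1) <= 4 / 3 :> R.
  by have := @expR_le_linear 4^-1; lra.
have h0 := expR_gt0 (4^-1 : R).
rewrite expRD; apply: (@le_trans _ _ (4 / 3 * (4 / 3))); last by lra.
by apply: ler_pM => //; exact: ltW.
Qed.

End cosh_bound.

Section density.
Context {R : realType} {n : nat}.
Variables (mu : probability 'rV[R]_n R) (X : set 'rV[R]_n) (f : 'rV[R]_n -> R).
Variables (m M : R).
Hypothesis mX : measurable X.
Hypothesis f_density : is_density_on mu X f.
Hypothesis m_gt0 : 0 < m.
Hypothesis f_bounds : forall x, X x -> m <= f x <= M.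
Local Notation leb := (lebesgue_rV n).

Lemma density_measure A : measurable A ->
  (m%:E * leb (A `&` X) <= mu A)%E /\ (mu A <= M%:E * leb (A `&` X))%E.
Proof.
move=> mA; have [mf ->//] := f_density.
have mAX : measurable (A `&` X) by exact: measurableI.
have mfAX : measurable_fun (A `&` X) (EFin \o f).
  by apply/measurable_EFinP; apply: measurable_funS mf.
rewrite -!integral_cst//; split; apply: ge0_le_integral => //.
- by move=> x _; rewrite lee_fin ltW.
- by move=> x [_ /f_bounds/andP[h _]]; rewrite lee_fin.
- by move=> x [_ /f_bounds/andP[h _]]; rewrite lee_fin (le_trans _ h)// ltW.
- by move=> x [_ /f_bounds/andP[_ h]]; rewrite lee_fin.
Qed.

Lemma density_support : mu X = 1%E.
Proof.
have [_ h] := f_density.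
transitivity (mu setT); last exact: probability_setT.
by rewrite !h// setIid setTI.
Qed.

Lemma bounded_density_pos : exists x, X x.
Proof.
apply/set0P/negP => /eqP X0.
by have := density_support; rewrite X0 measure0 => /eqP; rewrite eq_sym onee_eq0.
Qed.

Lemma M_gt0 : 0 < M.
Proof.
have [x Xx] := bounded_density_pos; have /andP[h1 h2] := f_bounds Xx.
exact: lt_le_trans m_gt0 (le_trans h1 h2).
Qed.

Lemma leb_support_lty : (leb X < +oo)%E.
Proof.
have [+ _] := density_measure mX; rewrite setIid density_support.
move=> h; rewrite ltNge leye_eq; apply/negP => /eqP Xoo.
by move: h; rewrite Xoo gt0_muley ?lte_fin// leye_eq.
Qed.

Lemma leb_support_gt0 : (0 < leb X)%E.
Proof.
have [_] := density_measure mX; rewrite setIid density_support.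
by rewrite lt0e measure_ge0 andbT; apply: contraTN => /eqP ->; rewrite mule0 -ltNge.
Qed.

(** The bounds on the density compare [mu] with multiples of Lebesgue measure restricted to [X] as
    measures, and integrals of nonnegative functions are monotone in the measure. *)
Lemma density_integral (g : 'rV[R]_n -> \bar R) : measurable_fun setT g ->
  (forall x, (0 <= g x)%E) ->
  (m%:E * \int[leb]_(x in X) g x <= \int[mu]_(x in X) g x)%E /\
  (\int[mu]_(x in X) g x <= M%:E * \int[leb]_(x in X) g x)%E.
Proof.
move=> mg g0.
have mgX : measurable_fun X g by exact: measurable_funTS.
have key k (k0 : 0 <= k) : (k%:E * \int[leb]_(x in X) g x =
    \int[mscale (NngNum k0) (mrestr leb mX)]_(x in X) g x)%E.
  rewrite ge0_integral_mscale//; congr (_ * _)%E.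
  by apply: eq_measure_integral => A mA AX /=; rewrite /mrestr setIidl.
rewrite (key _ (ltW m_gt0)) (key _ (ltW M_gt0)).
split; apply: ge0_le_measure_integral => // A mA.
  by have [h _] := density_measure mA.
by have [_ h] := density_measure mA.
Qed.

Lemma density_Rintegral (g : 'rV[R]_n -> R) : bmeas g ->
  (forall x, X x -> 0 <= g x) ->
  m * \int[leb]_(x in X) g x <= \int[mu]_x g x <= M * \int[leb]_(x in X) g x.
Proof.
move=> bg g0; have [mg [B gB]] := bg.
have muXC : mu (~` X) = 0%E.
  by rewrite probability_setC// density_support subee.
have gX : (\int[mu]_x (g x)%:E = \int[mu]_(x in X) (g x)%:E)%E.
  rewrite (negligible_integral (measurableC mX) measurableT _ muXC).
    by rewrite setTD setCK.
  exact: bmeas_integrable bg.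
have ptE (m' : {measure set 'rV[R]_n -> \bar R}) :
    (\int[m']_(x in X) (g x)%:E = \int[m']_(x in X) ((g \_ X) x)%:E)%E.
  by apply: eq_integral => x xX; rewrite patchE xX.
have mgX : measurable_fun setT (EFin \o (g \_ X)).
  apply/measurable_EFinP; apply/(measurable_restrictT _ mX).
  exact: (measurable_funTS mg).
have gX0 x : (0 <= ((g \_ X) x)%:E)%E.
  by rewrite lee_fin patchE; case: ifPn => // /set_mem/g0.
have [h1 h2] := density_integral mgX gX0.
rewrite -!(ptE leb) -!(ptE mu) -gX in h1 h2.
have ig : leb.-integrable X (EFin \o g).
  apply: measurable_bounded_integrable => //; first exact: leb_support_lty.
    exact: measurable_funTS.
  exists B; split; first exact: num_real.
  by move=> x Bx y _ /=; exact: le_trans (gB y) (ltW Bx).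
have fl : (\int[leb]_(x in X) (g x)%:E)%E \is a fin_num by exact: integrable_fin_num ig.
have fm : (\int[mu]_x (g x)%:E)%E \is a fin_num.
  by apply: integrable_fin_num => //; exact: bmeas_integrable bg.
by rewrite /Rintegral -!lee_fin !EFinM !fineK// h1 h2.
Qed.

End density.

Lemma osc_interval {R : realType} {T : Type} (pt : T) (u : T -> R) K :
  (forall x x', u x - u x' <= K) -> exists a, forall x, a <= u x <= a + K.
Proof.
move=> uK.
have su : has_sup (range u).
  split; first by exists (u pt), pt.
  by exists (u pt + K) => _ [x _ <-]; have := uK x pt; rewrite lerBlDl.
exists (sup (range u) - K) => x; apply/andP; split.
  rewrite lerBlDr; apply: ge_sup; first by exists (u pt), pt.
  by move=> _ [x' _ <-]; have := uK x' x; rewrite lerBlDl.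
by rewrite subrK; apply: sup_upper_bound => //; exists x.
Qed.

(** Lowering the second function by [k] makes the two exponential integrals equal, so that their
    geometric mean in Prekopa-Leindler is also their arithmetic mean. *)
Lemma balancing_shift {R : realType} (s z0 z1 zh : R) :
  0 < s -> 0 < z0 -> 0 < z1 -> 0 < zh -> z0 * z1 <= zh ^+ 2 ->
  exists2 k, expR (- (s * k)) * z1 = z0 & z0 <= expR (- (s * k) / 2) * zh.
Proof.
move=> s0 z00 z10 zh0 zz; exists (ln (z1 / z0) / s).
  rewrite mulrC (mulrC s) divfK ?gt_eqF// expRN lnK ?posrE ?divr_gt0//.
  by rewrite invf_div mulrC divfK// gt_eqF.
rewrite (mulrC s) divfK ?gt_eqF//; set l := ln _.
have q0 := expR_gt0 (- l / 2).
have qq : expR (- l / 2) ^+ 2 = z0 / z1.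
  by rewrite expr2 -expRD -splitr expRN lnK ?posrE ?divr_gt0// invf_div.
have h1 : 0 <= z0 by exact: ltW.
have h2 : 0 <= expR (- l / 2) * zh by rewrite mulr_ge0// ltW.
rewrite -(ler_pXn2r (n := 2))// ?nnegrE// exprMn qq.
have -> : z0 ^+ 2 = z0 / z1 * (z0 * z1) by field; rewrite gt_eqF.
by rewrite ler_pM2l// divr_gt0.
Qed.

Section pl_variance.
Context {R : realType} {n : nat}.
Variables (mu : probability 'rV[R]_n R) (X : set 'rV[R]_n) (f : 'rV[R]_n -> R).
Variables (m M r : R).
Hypothesis mX : measurable X.
Hypothesis f_density : is_density_on mu X f.
Hypothesis m_gt0 : 0 < m.
Hypothesis f_bounds : forall x, X x -> m <= f x <= M.
Hypothesis X_bounded : forall x, X x -> forall i, `|x 0 i| <= r.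
Local Notation leb := (lebesgue_rV n).

Lemma integrable_support (g : 'rV[R]_n -> R) : bmeas g -> leb.-integrable X (EFin \o g).
Proof.
move=> [mg [B gB]]; apply: measurable_bounded_integrable => //.
- exact: leb_support_lty mX f_density m_gt0 f_bounds.
- exact: measurable_funTS.
exists B; split; first exact: num_real.
by move=> x Bx y _ /=; exact: le_trans (gB y) (ltW Bx).
Qed.

Lemma tame_restrict (g : 'rV[R]_n -> R) : bmeas g -> (forall x, 0 <= g x) ->
  tame (g \_ X).
Proof.
move=> [mg [B gB]] g0; split.
  by apply/(measurable_restrictT _ mX); exact: measurable_funTS.
exists B, r => x; split.
  rewrite patchE; case: ifPn => _; first by rewrite g0/= (le_trans (ler_norm _)).
  have -> : point = 0 :> R by [].
  by rewrite lexx/= (le_trans _ (gB x)).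
move=> [i ri]; rewrite patchE; case: ifPn => // /set_mem/X_bounded/(_ i).
by rewrite leNgt ri.
Qed.

Lemma int_support_gt0 (g : 'rV[R]_n -> R) e : bmeas g -> 0 < e ->
  (forall x, e <= g x) -> 0 < \int[leb]_(x in X) g x.
Proof.
move=> bg e0 ge.
apply: (@lt_le_trans _ _ (\int[leb]_(x in X) e)).
  rewrite Rintegral_cst// mulr_gt0//; apply: fine_gt0; apply/andP; split.
    exact: (leb_support_gt0 mX f_density m_gt0 f_bounds).
  exact: (leb_support_lty mX f_density m_gt0 f_bounds).
apply: le_Rintegral => //; apply: integrable_support => //; exact: bmeas_cst.
Qed.

Lemma prekopa_leindler_exp s (u0 u1 uh : 'rV[R]_n -> R) :
  bmeas u0 -> bmeas u1 -> bmeas uh ->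
  (forall x y, X x -> X y -> X (2^-1 *: (x + y)) /\
     s * u0 x + s * u1 y <= 2 * (s * uh (2^-1 *: (x + y)))) ->
  (\int[leb]_(x in X) expR (s * u0 x)) * (\int[leb]_(x in X) expR (s * u1 x)) <=
  (\int[leb]_(x in X) expR (s * uh x)) ^+ 2.
Proof.
move=> b0 b1 bh mid.
have te u : bmeas u -> tame ((fun x => expR (s * u x)) \_ X).
  by move=> bu; apply: tame_restrict => [|x]; [bm|exact: expR_ge0].
rewrite (Rintegral_mkcond _ _ (fun x => expR (s * u0 x))).
rewrite (Rintegral_mkcond _ _ (fun x => expR (s * u1 x))).
rewrite (Rintegral_mkcond _ _ (fun x => expR (s * uh x))).
apply: (prekopa_leindler (te _ b0) (te _ b1) (te _ bh)).
move=> x y; rewrite !patchE; case: ifPn => [/set_mem Xx|_]; last first.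
  by rewrite mul0r sqr_ge0.
case: ifPn => [/set_mem Xy|_]; last by rewrite mulr0 sqr_ge0.
have [Xm h] := mid _ _ Xx Xy; rewrite mem_set//=.
by rewrite expr2 -!expRD ler_expR; apply: le_trans h _; lra.
Qed.

(** After balancing, Prekopa-Leindler says that the integral of W (cosh t - exp y) over [X] is at
    most 0, where t is proportional to u1 - u0 - k and y to the midpoint gap. Expanding cosh to
    second order and the exponential to first order bounds the variance by the gap. *)
Lemma variance_le_midpoint_gap (u0 u1 uh : 'rV[R]_n -> R) (K : R) : 0 < K ->
  bmeas u0 -> bmeas u1 -> bmeas uh ->
  (forall x x', u0 x - u0 x' <= K) -> (forall x x', u1 x - u1 x' <= K) ->
  (forall x y, X x -> X y -> X (2^-1 *: (x + y)) /\
     (u0 x + u1 y) / 2 <= uh (2^-1 *: (x + y))) ->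
  (forall x, X x -> 0 <= uh x - (u0 x + u1 x) / 2 <= K / 2) ->
  exists k, \int[mu]_x (u1 x - u0 x - k) ^+ 2 <=
    38 * (M / m) * K * \int[mu]_x (uh x - (u0 x + u1 x) / 2).
Proof.
move=> K0 b0 b1 bh o0 o1 mid hK.
(* With s K = 1/2 the weight W varies by a factor at most exp(1/2) <= 16/9, and y <= 1/4 makes
   [expR_le_linear] available. *)
pose s := (2 * K)^-1.
have s0 : 0 < s by rewrite invr_gt0 mulr_gt0.
have sK : s * K = 2^-1 by rewrite /s; field; rewrite gt_eqF.
have be (u : 'rV[R]_n -> R) : bmeas u -> bmeas (fun x => expR (s * u x)) by move=> ?; bm.
have Zgt0 u : bmeas u -> 0 < \int[leb]_(x in X) expR (s * u x).
  move=> bu; have [_ [B gB]] : bmeas (fun x => s * u x) by bm.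
  apply: (@int_support_gt0 _ (expR (- B))); [exact: be|exact: expR_gt0|move=> x].
  by rewrite ler_expR; have := gB x; rewrite ler_norml => /andP[].
have PL := prekopa_leindler_exp (s := s) b0 b1 bh.
set Z0 := \int[leb]_(x in X) expR (s * u0 x) in PL.
set Z1 := \int[leb]_(x in X) expR (s * u1 x) in PL.
set Zh := \int[leb]_(x in X) expR (s * uh x) in PL.
have {}PL : Z0 * Z1 <= Zh ^+ 2.
  apply: PL => x y Xx Xy; have [Xm h] := mid _ _ Xx Xy; split => //.
  by have := ler_wpM2l (ltW s0) h; lra.
have Z00 : 0 < Z0 by exact: Zgt0.
have Z10 : 0 < Z1 by exact: Zgt0.
have Zh0 : 0 < Zh by exact: Zgt0.
have [k q2 qZh] := balancing_shift s0 Z00 Z10 Zh0 PL.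
pose q := expR (- (s * k) / 2).
rewrite -/q in qZh.
have q0 : 0 < q := expR_gt0 _.
have [a0 ha0] : exists a, forall x, a <= (u0 x + u1 x) / 2 <= a + K.
  apply: (osc_interval (0 : 'rV[R]_n)) => x x'.
  by have := o0 x x'; have := o1 x x'; lra.
pose w := expR (s * a0 - s * k / 2).
have w0 : 0 < w := expR_gt0 _.
pose A x := s ^+ 2 / 8 * (u1 x - u0 x - k) ^+ 2.
pose H x := 64 / 27 * s * (uh x - (u0 x + u1 x) / 2).
have bA : bmeas A by rewrite /A; bm.
have bH : bmeas H by rewrite /H; bm.
have be0 := be _ b0; have be1 := be _ b1; have beh := be _ bh.
(* The right side is W (cosh t - exp y); [w] is a lower bound of W, and the factor 64/27 in [H] is
   16/9 times 4/3. *)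
have pointwise x : X x -> w * (A x - H x) <=
    2^-1 * expR (s * u0 x) + 2^-1 * expR (- (s * k)) * expR (s * u1 x) -
    q * expR (s * uh x).
  move=> Xx; have /andP[h0 hK2] := hK _ Xx.
  pose t := s * (u1 x - u0 x - k) / 2.
  pose W := expR (s * ((u0 x + u1 x) / 2) - s * k / 2).
  have -> : expR (s * u0 x) = W * expR (- t).
    by rewrite -expRD; congr expR; rewrite /t; field.
  have -> : 2^-1 * expR (- (s * k)) * expR (s * u1 x) = 2^-1 * (W * expR t).
    by rewrite -mulrA -!expRD; congr (_ * expR _); rewrite /t; field.
  have -> : q * expR (s * uh x) = W * expR (s * (uh x - (u0 x + u1 x) / 2)).
    by rewrite -!expRD; congr expR; field.
  have W0 : 0 < W := expR_gt0 _.
  have /andP[a1 a2] := ha0 x.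
  have wW : w <= W by rewrite ler_expR lerD2r ler_pM2l.
  have Ww : W <= w * (16 / 9).
    apply: (@le_trans _ _ (w * expR (2^-1))); last first.
      by rewrite ler_pM2l// expR_half_le.
    rewrite -expRD ler_expR; have h := ler_wpM2l (ltW s0) a2.
    by rewrite (mulrDr s a0) in h; lra.
  have AE : A x = t ^+ 2 / 2 by rewrite /A /t; field.
  pose y := s * (uh x - (u0 x + u1 x) / 2).
  have y0 : 0 <= y by rewrite mulr_ge0// ltW.
  have y1 : y <= 1 / 4 by have := ler_wpM2l (ltW s0) hK2; rewrite mulrA sK -/y; lra.
  have HE : w * H x = w * (16 / 9) * (4 / 3 * y) by rewrite /H /y; field.
  rewrite -/y mulrBr HE AE.
  have h1 : w * (t ^+ 2 / 2) <= W * (t ^+ 2 / 2).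
    by rewrite ler_wpM2r// divr_ge0// sqr_ge0.
  have h2 : W * (4 / 3 * y) <= w * (16 / 9) * (4 / 3 * y).
    by apply: ler_wpM2r Ww; rewrite mulr_ge0.
  have h3 : W * expR y <= W * (1 + 4 / 3 * y).
    by rewrite ler_pM2l//; exact: expR_le_linear.
  have h4 : W * (2 + t ^+ 2) <= W * (expR t + expR (- t)).
    by rewrite ler_pM2l//; exact: cosh_ge.
  move: (w * (16 / 9) * (4 / 3 * y)) (w * (t ^+ 2 / 2)) h1 h2 => c1 c2 h1 h2.
  rewrite mulrDr mulr1 in h3; rewrite !mulrDr in h4; lra.
have iX g : bmeas g -> leb.-integrable X (EFin \o g) by exact: integrable_support.
(* The upper bound integrates to Z0 / 2 + Z0 / 2 - q Zh, nonpositive by the choice of [k]. *)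
have key : \int[leb]_(x in X) (w * (A x - H x)) <= 0.
  apply: (@le_trans _ _ (\int[leb]_(x in X) (2^-1 * expR (s * u0 x) +
      2^-1 * expR (- (s * k)) * expR (s * u1 x) - q * expR (s * uh x)))).
    by apply: le_Rintegral => //; apply: iX; bm.
  rewrite RintegralB//; [|by apply: iX; bm..].
  rewrite RintegralD//; [|by apply: iX; bm..].
  rewrite !RintegralZl//; [|exact: iX..].
  by rewrite -/Z0 -/Z1 -/Zh -mulrA q2; lra.
exists k.
have AH : \int[leb]_(x in X) A x <= \int[leb]_(x in X) H x.
  have iA := iX _ bA; have iH := iX _ bH.
  have iAH := iX _ (bmeasB bA bH).
  by rewrite (RintegralZl _ mX iAH) (RintegralB mX iA iH) pmulr_rle0// subr_le0 in key.
have bsq : bmeas (fun x => (u1 x - u0 x - k) ^+ 2) by bm.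
have bg : bmeas (fun x => uh x - (u0 x + u1 x) / 2) by bm.
rewrite /A /H (RintegralZl _ mX (iX _ bsq)) (RintegralZl _ mX (iX _ bg)) in AH.
(* Returning to [mu] costs [M] on the variance and [m] on the gap, whence the ratio M / m. *)
have /andP[_ d1] := density_Rintegral mX f_density m_gt0 f_bounds bsq (fun x _ => sqr_ge0 _).
have /andP[d2 _] : m * \int[leb]_(x in X) (uh x - (u0 x + u1 x) / 2) <=
    \int[mu]_x (uh x - (u0 x + u1 x) / 2) <=
    M * \int[leb]_(x in X) (uh x - (u0 x + u1 x) / 2).
  by apply: (density_Rintegral mX f_density m_gt0 f_bounds bg) => x /hK/andP[].
have M0 := M_gt0 mX f_density m_gt0 f_bounds.
have G0 : 0 <= \int[leb]_(x in X) (uh x - (u0 x + u1 x) / 2).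
  by apply: Rintegral_ge0 => x /hK/andP[].
apply: le_trans d1 _; move: G0 AH d2.
move: (\int[leb]_(x in X) (u1 x - u0 x - k) ^+ 2)
  (\int[leb]_(x in X) (uh x - (u0 x + u1 x) / 2))
  (\int[mu]_x (uh x - (u0 x + u1 x) / 2)) => V G I G0 AH d2.
(* 8 / s^2 times 64 s / 27 with 1 / s = 2 K; 1024/27 is just below 38. *)
have VG : V <= 1024 / 27 * (K * G).
  have s20 : 0 < s ^+ 2 / 8 by rewrite divr_gt0// exprn_gt0.
  rewrite -(ler_pM2l s20); apply: le_trans AH _.
  rewrite le_eqVlt; apply/orP; left; apply/eqP.
  have -> : s ^+ 2 / 8 * (1024 / 27 * (K * G)) = 128 / 27 * s * (s * K) * G by field.
  by rewrite sK; field.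
have GI : K * G <= K * (I / m) by rewrite ler_pM2l// ler_pdivlMr// mulrC.
have -> : 38 * (M / m) * K * I = M * (38 * (K * (I / m))) by field; rewrite gt_eqF.
have KG0 : 0 <= K * G by rewrite mulr_ge0// ltW.
by rewrite ler_pM2l//; lra.
Qed.

End pl_variance.

Section midpoint_variance.
Context {R : realType} {n : nat} {d2} {T2 : measurableType d2}.
Variables (mu : probability 'rV[R]_n R) (nu : probability T2 R).
Variables (X : set 'rV[R]_n) (f : 'rV[R]_n -> R).
Variables (c : 'rV[R]_n -> T2 -> R) (lambda K m M r : R) (y0 : T2).
Hypothesis mX : measurable X.
Hypothesis f_density : is_density_on mu X f.
Hypothesis m_gt0 : 0 < m.
Hypothesis f_bounds : forall x, X x -> m <= f x <= M.
Hypothesis X_bounded : forall x, X x -> forall i, `|x 0 i| <= r.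
Hypothesis bc : bmeas (fun p : 'rV[R]_n * T2 => c p.1 p.2).
Hypothesis lambda_gt0 : 0 < lambda.
Hypothesis K_ge0 : 0 <= K.
Hypothesis c_osc : forall x x' y y', c x y - c x' y' <= K.
Hypothesis c_mid : forall x x' y, X x -> X x' ->
  X (2^-1 *: (x + x')) /\ c (2^-1 *: (x + x')) y = (c x y + c x' y) / 2.

Local Notation trl := (transform_r nu c lambda).

(** By [le_trf] it suffices that the averaged value gives mass at most 1. As the cost is affine at
    the midpoint, the integrand is the geometric mean of two densities of unit mass. *)
Lemma trl_midpoint psi0 psi1 x x' : bmeas psi0 -> bmeas psi1 -> X x -> X x' ->
  (trl psi0 x + trl psi1 x') / 2 <=
  trl (fun y => (psi0 y + psi1 y) / 2) (2^-1 *: (x + x')).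
Proof.
move=> b0 b1 Xx Xx'.
have bh : bmeas (fun y => (psi0 y + psi1 y) / 2) by bm.
apply: (le_trf bc lambda_gt0 bh).
have g0 := bmeas_gibbs_section lambda bc (trl psi0 x) x b0.
have g1 := bmeas_gibbs_section lambda bc (trl psi1 x') x' b1.
have gh := bmeas_gibbs_section lambda bc ((trl psi0 x + trl psi1 x') / 2)
  (2^-1 *: (x + x')) bh.
have m0 := trf_mass nu bc lambda_gt0 x b0.
have m1 := trf_mass nu bc lambda_gt0 x' b1.
have cm y := (c_mid y Xx Xx').2.
move: (trl psi0 x) (trl psi1 x') g0 g1 gh m0 m1 => p0 p1 g0 g1 gh m0 m1.
apply: (@le_trans _ _ (2^-1 * (\int[nu]_y expR ((p0 + psi0 y - c x y) / lambda) +
    \int[nu]_y expR ((p1 + psi1 y - c x' y) / lambda)))); last first.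
  by rewrite m0 m1; lra.
have g01 := bmeasD g0 g1.
rewrite -intD// -intZ//.
apply: le_int; [exact: gh|exact: (bmeasM (bmeas_cst 2^-1) g01)|move=> y]; rewrite cm.
set A := (p0 + psi0 y - c x y) / lambda; set B := (p1 + psi1 y - c x' y) / lambda.
have -> : ((p0 + p1) / 2 + (psi0 y + psi1 y) / 2 - (c x y + c x' y) / 2) / lambda =
    A / 2 + B / 2 by rewrite /A /B; field; rewrite gt_eqF.
rewrite expRD.
have eA : expR A = expR (A / 2) ^+ 2 by rewrite expr2 -expRD -splitr.
have eB : expR B = expR (B / 2) ^+ 2 by rewrite expr2 -expRD -splitr.
rewrite eA eB; have := sqr_ge0 (expR (A / 2) - expR (B / 2)).
by rewrite sqrrB; lra.
Qed.

(** psi1 - psi0 lies in an interval [a, a + 2 K]; the averaged potential is compared with each of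
    the two and the bounds are averaged, which removes a. *)
Lemma trl_gap_le psi0 psi1 x : bmeas psi0 -> bmeas psi1 ->
  (forall y y', psi0 y - psi0 y' <= K) -> (forall y y', psi1 y - psi1 y' <= K) ->
  trl (fun y => (psi0 y + psi1 y) / 2) x - (trl psi0 x + trl psi1 x) / 2 <= K / 2.
Proof.
move=> b0 b1 o0 o1.
have bh : bmeas (fun y => (psi0 y + psi1 y) / 2) by bm.
have [a ha] : exists a, forall y, a <= psi1 y - psi0 y <= a + 2 * K.
  by apply: (osc_interval y0) => y y'; have := o0 y' y; have := o1 y y'; lra.
have h0 : trl (fun y => (psi0 y + psi1 y) / 2) x <= trl psi0 x + - a / 2.
  by apply: (trf_le nu bc lambda_gt0 bh b0) => y; have /andP[] := ha y; lra.
have h1 : trl (fun y => (psi0 y + psi1 y) / 2) x <= trl psi1 x + (a / 2 + K).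
  by apply: (trf_le nu bc lambda_gt0 bh b1) => y; have /andP[] := ha y; lra.
move: (trl _ x) (trl _ x) (trl _ x) h0 h1 => p q s; lra.
Qed.

Lemma trl_variance_le psi0 psi1 : bmeas psi0 -> bmeas psi1 ->
  (forall y y', psi0 y - psi0 y' <= K) -> (forall y y', psi1 y - psi1 y' <= K) ->
  exists k, \int[mu]_x (trl psi1 x - trl psi0 x - k) ^+ 2 <= 38 * (M / m) * K *
  \int[mu]_x (trl (fun y => (psi0 y + psi1 y) / 2) x - (trl psi0 x + trl psi1 x) / 2).
Proof.
move=> b0 b1 o0 o1.
have bh : bmeas (fun y => (psi0 y + psi1 y) / 2) by bm.
have osc psi : bmeas psi -> forall x x', trl psi x - trl psi x' <= K.
  move=> bpsi x x'; rewrite lerBlDl.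
  by apply: (trf_osc nu bc lambda_gt0 bpsi) => y; exact: c_osc.
have [K0|K0] := eqVneq K 0.
  exists (trl psi1 0 - trl psi0 0).
  rewrite K0 mulr0 mul0r; rewrite -[leRHS](int_cst mu) le_eqVlt; apply/orP; left.
  apply/eqP; apply: eq_int => x.
  have cst psi : bmeas psi -> trl psi x = trl psi 0.
    move=> bpsi; have h1 := osc psi bpsi x 0; have h2 := osc psi bpsi 0 x.
    rewrite K0 in h1 h2.
    by apply: le_anti; apply/andP; split; rewrite -subr_le0; [exact: h1|exact: h2].
  by rewrite !cst// subrr expr0n.
apply: (variance_le_midpoint_gap mX f_density m_gt0 f_bounds X_bounded).
- by rewrite lt_def K0 K_ge0.
- exact: bmeas_trf b0.
- exact: bmeas_trf b1.
- exact: bmeas_trf bh.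
- exact: osc.
- exact: osc.
- move=> x y Xx Xy; split; last exact: trl_midpoint.
  by have [] := c_mid y0 Xx Xy.
- move=> x Xx; apply/andP; split; last exact: trl_gap_le.
  (* Nonnegativity of the gap is the midpoint inequality at equal points. *)
  have xx : 2^-1 *: (x + x) = x.
    have h2 : 2^-1 + 2^-1 = 1 :> R by lra.
    by rewrite scalerDr -scalerDl h2 scale1r.
  by have := trl_midpoint b0 b1 Xx Xx; rewrite xx subr_ge0.
Qed.

End midpoint_variance.

(** * Changing the cost and the potentials on null sets *)

Section almost_everywhere.
Context {R : realType}.

(** Explicit sets of full measure can be intersected and multiplied, as the iterates and the double
    integral require. *)
Definition full d (T : measurableType d) (m : {measure set T -> \bar R})
  (A : set T) := measurable A /\ m (~` A) = 0%E.

Lemma fullI d (T : measurableType d) (m : {measure set T -> \bar R}) A B :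
  full m A -> full m B -> full m (A `&` B).
Proof.
move=> [mA A0] [mB B0]; split; first exact: measurableI.
apply/eqP; rewrite -measure_le0 setCI.
apply: (@le_trans _ _ (m (~` A) + m (~` B))%E); last by rewrite A0 B0 adde0.
by apply: measureU2; exact: measurableC.
Qed.

Lemma int_eq_full d (T : measurableType d) (m : {measure set T -> \bar R})
    (A : set T) (f g : T -> R) : full m A ->
  measurable_fun setT f -> measurable_fun setT g ->
  (forall x, A x -> f x = g x) -> \int[m]_x f x = \int[m]_x g x.
Proof.
move=> [mA mA0] mf mg fg; congr fine.
apply: ae_eq_integral => //; try exact/measurable_EFinP.
exists (~` A); split => //; first exact: measurableC.
by move=> x /= /not_implyP[_ h] Ax; apply: h; rewrite fg.
Qed.

Lemma fullX d1 d2 (T1 : measurableType d1) (T2 : measurableType d2)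
    (P : probability T1 R) (Q : probability T2 R) (A : set T1) (B : set T2) :
  full P A -> full Q B -> full (P \x Q)%E (A `*` B).
Proof.
move=> [mA A0] [mB B0]; split; first exact: measurableX.
apply/eqP; rewrite -measure_le0.
have mAC : measurable (~` A `*` [set: T2]) by apply: measurableX => //; exact: measurableC.
have mBC : measurable ([set: T1] `*` ~` B) by apply: measurableX => //; exact: measurableC.
apply: (@le_trans _ _ ((P \x Q)%E (~` A `*` setT `|` setT `*` ~` B))).
  apply: le_measure; rewrite ?inE.
  + by apply: measurableC; exact: measurableX.
  + exact: measurableU.
  + move=> [x y] /= /not_andP[Ax|By]; [left|right]; split => //.
apply: le_trans (measureU2 _ _ _) _ => //.
have a0 : ((P \x Q) (~` A `*` setT) <= 0)%E.
  rewrite product_measure1E//; last exact: measurableC.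
  by rewrite [X in (X * _)%E](_ : _ = 0%E)// mul0e.
have b0 : ((P \x Q) (setT `*` ~` B) <= 0)%E.
  rewrite product_measure1E//; last exact: measurableC.
  by rewrite [X in (_ * X)%E](_ : _ = 0%E)// mule0.
by have := leeD a0 b0; rewrite adde0; exact.
Qed.

End almost_everywhere.

Section cost_change.
Context {R : realType} {d1 d2} {T1 : measurableType d1} {T2 : measurableType d2}.
Variables (mu : probability T1 R) (nu : probability T2 R).
Variables (X : set T1) (Y : set T2).
Variables (c c' : T1 -> T2 -> R) (lambda : R).
Hypothesis fX : full mu X.
Hypothesis fY : full nu Y.
Hypothesis mc : measurable_fun setT (fun p : T1 * T2 => c p.1 p.2).
Hypothesis mc' : measurable_fun setT (fun p : T1 * T2 => c' p.1 p.2).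
Hypothesis cc' : forall x y, X x -> Y y -> c x y = c' x y.

Lemma measurable_transform_r (c0 : T1 -> T2 -> R) psi :
  measurable_fun setT (fun p : T1 * T2 => c0 p.1 p.2) ->
  measurable_fun setT psi -> measurable_fun setT (transform_r nu c0 lambda psi).
Proof.
move=> mc0 mpsi; apply: measurable_funM; first exact: measurable_cst.
apply: (measurableT_comp (@measurable_ln R)).
have mk : measurable_fun setT (fun p : T1 * T2 =>
    (expR ((psi p.2 - c0 p.1 p.2) / lambda))%:E).
  apply/measurable_EFinP; apply: (measurableT_comp (@measurable_expR R)).
  apply: measurable_funM => //; apply: measurable_funB => //.
  exact: (measurableT_comp mpsi measurable_snd).
have h := measurable_fun_fubini_tonelli_F (m2 := nu) _ mk.
by apply: (measurableT_comp (fine_measurable measurableT)); apply: h => p; rewrite lee_fin expR_ge0.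
Qed.

Lemma transform_r_eq psi psi' A x : full nu A -> X x ->
  measurable_fun setT psi -> measurable_fun setT psi' ->
  (forall y, A y -> psi y = psi' y) ->
  transform_r nu c lambda psi x = transform_r nu c' lambda psi' x.
Proof.
move=> fA Xx mpsi mpsi' h; congr (- lambda * ln _).
have mk (u : T2 -> R) (c0 : T1 -> T2 -> R) :
    measurable_fun setT (fun p : T1 * T2 => c0 p.1 p.2) -> measurable_fun setT u ->
    measurable_fun setT (fun y => expR ((u y - c0 x y) / lambda)).
  move=> m0 mu0; apply: (measurableT_comp (@measurable_expR R)).
  apply: measurable_funM => //; apply: measurable_funB => //.
  exact: (measurableT_comp m0 (pair1_measurable x)).
apply: (int_eq_full (fullI fA fY)); [exact: mk|exact: mk|].
by move=> y [Ay Yy]; rewrite h// cc'.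
Qed.

Lemma dual_eq_full phi phi' psi psi' A B : full mu A -> full nu B ->
  measurable_fun setT phi -> measurable_fun setT phi' ->
  measurable_fun setT psi -> measurable_fun setT psi' ->
  (forall x, A x -> phi x = phi' x) -> (forall y, B y -> psi y = psi' y) ->
  dual mu nu c lambda phi psi = dual mu nu c' lambda phi' psi'.
Proof.
move=> fA fB mphi mphi' mpsi mpsi' hA hB.
have mk (u : T1 -> R) (v : T2 -> R) (c0 : T1 -> T2 -> R) :
    measurable_fun setT (fun p : T1 * T2 => c0 p.1 p.2) ->
    measurable_fun setT u -> measurable_fun setT v ->
    measurable_fun setT (fun p : T1 * T2 => expR ((u p.1 + v p.2 - c0 p.1 p.2) / lambda)).
  move=> m0 mu0 mv0; apply: (measurableT_comp (@measurable_expR R)).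
  apply: measurable_funM => //; apply: measurable_funB => //.
  apply: measurable_funD.
    exact: (measurableT_comp mu0 measurable_fst).
  exact: (measurableT_comp mv0 measurable_snd).
rewrite /dual (int_eq_full fA mphi mphi' hA) (int_eq_full fB mpsi mpsi' hB).
have fAB := fullX (fullI fA fX) (fullI fB fY).
rewrite (int_eq_full fAB (mk _ _ _ mc mphi mpsi) (mk _ _ _ mc' mphi' mpsi'))//.
by move=> [x y] [[/= Ax Xx] [By Yy]]; rewrite hA// hB// cc'.
Qed.

End cost_change.

Section sinkhorn_cost_change.
Context {R : realType} {d1 d2} {T1 : measurableType d1} {T2 : measurableType d2}.
Variables (mu : probability T1 R) (nu : probability T2 R).
Variables (X : set T1) (Y : set T2).
Variables (c c' : T1 -> T2 -> R) (lambda : R).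
Hypothesis fX : full mu X.
Hypothesis fY : full nu Y.
Hypothesis mc : measurable_fun setT (fun p : T1 * T2 => c p.1 p.2).
Hypothesis mc' : measurable_fun setT (fun p : T1 * T2 => c' p.1 p.2).
Hypothesis cc' : forall x y, X x -> Y y -> c x y = c' x y.

Let measurable_cost_swap (c0 : T1 -> T2 -> R) :
  measurable_fun setT (fun p : T1 * T2 => c0 p.1 p.2) ->
  measurable_fun setT (fun p : T2 * T1 => c0 p.2 p.1).
Proof. by move=> mc0; have := measurableT_comp mc0 (@measurable_swap _ _ T2 T1); exact. Qed.

Lemma sinkhorn_psi_eq_full psi0 psi0' A : full nu A ->
  measurable_fun setT psi0 -> measurable_fun setT psi0' ->
  (forall y, A y -> psi0 y = psi0' y) -> forall t,
  [/\ measurable_fun setT (sinkhorn_psi mu nu c lambda psi0 t),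
      measurable_fun setT (sinkhorn_psi mu nu c' lambda psi0' t) &
      exists2 B, full nu B & forall y, B y ->
        sinkhorn_psi mu nu c lambda psi0 t y = sinkhorn_psi mu nu c' lambda psi0' t y].
Proof.
move=> fA m0 m0' h0; elim=> [|t [mt mt' [B fB hB]]]; first by split => //; exists A.
have mp := measurable_transform_r nu lambda mc mt.
have mp' := measurable_transform_r nu lambda mc' mt'.
have eqp x : X x -> transform_r nu c lambda (sinkhorn_psi mu nu c lambda psi0 t) x =
    transform_r nu c' lambda (sinkhorn_psi mu nu c' lambda psi0' t) x.
  by move=> Xx; exact: (transform_r_eq lambda fY mc mc' cc' fB Xx mt mt' hB).
split.
- exact: (measurable_transform_r mu lambda (c0 := fun y x => c x y) (measurable_cost_swap mc) mp).
- exact: (measurable_transform_r mu lambda (c0 := fun y x => c' x y) (measurable_cost_swap mc') mp').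
(* After one step the potentials agree on all of [Y]: there each transform is an integral over a set
   of full measure where costs and previous potentials agree. *)
exists Y; first exact: fY.
move=> y Yy.
exact: (transform_r_eq (c := fun y x => c x y) (c' := fun y x => c' x y) lambda fX
  (measurable_cost_swap mc) (measurable_cost_swap mc')
  (fun y x Yy Xx => cc' Xx Yy) fX Yy mp mp' eqp).
Qed.

Lemma dual_sinkhorn_eq_full psi0 psi0' A t : full nu A ->
  measurable_fun setT psi0 -> measurable_fun setT psi0' ->
  (forall y, A y -> psi0 y = psi0' y) ->
  dual mu nu c lambda (sinkhorn_phi mu nu c lambda psi0 t) (sinkhorn_psi mu nu c lambda psi0 t) =
  dual mu nu c' lambda (sinkhorn_phi mu nu c' lambda psi0' t)
    (sinkhorn_psi mu nu c' lambda psi0' t).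
Proof.
move=> fA m0 m0' h0.
have [mt mt' [B fB hB]] := sinkhorn_psi_eq_full fA m0 m0' h0 t.
apply: (dual_eq_full lambda fX fY mc mc' cc' fX fB _ _ mt mt' _ hB).
- exact: measurable_transform_r mc mt.
- exact: measurable_transform_r mc' mt'.
- by move=> x Xx; exact: (transform_r_eq lambda fY mc mc' cc' fB Xx mt mt' hB).
Qed.

End sinkhorn_cost_change.

Section Linfty.
Context {R : realType} {d} {T : measurableType d} (P : probability T R).

Lemma bmeas_Linfty (g : T -> R) : bmeas g -> g \in Lfun P +oo%E.
Proof.
move=> [mg [B gB]]; rewrite !inE; apply/andP; split; rewrite inE//=.
rewrite /finite_norm unlock /Lnorm.
case: ifPn => // _; apply: (@le_lt_trans _ _ B%:E); last exact: ltry.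
by apply/ess_supP; apply: nearW => x /=; rewrite lee_fin.
Qed.

(** Clipping at an essential bound changes [g] only on a null set. *)
Lemma Linfty_truncation (g : T -> R) : g \in Lfun P +oo%E ->
  measurable_fun setT g /\
  exists g' A, [/\ bmeas g', full P A & forall x, A x -> g x = g' x].
Proof.
rewrite !inE => /andP[/[1!inE]/= mg].
rewrite !inE/= /finite_norm unlock /Lnorm.
have -> : (0 < (P : {measure set T -> \bar R}) setT)%E.
  by rewrite [X in (_ < X)%E](_ : _ = 1%E)//; exact: probability_setT.
move=> goo; split => //.
have [B hB] := ess_supr_bounded goo.
pose g' x := Num.max (- B) (Num.min B (g x)).
have mabs : measurable_fun setT (fun x => `|g x|) by exact: measurableT_comp.
have mA : measurable [set x | `|g x| <= B].
  have := measurable_fun_le measurableT mabs (measurable_cst B); rewrite setTI; exact.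
exists g', [set x | `|g x| <= B]; split.
- split; first by apply: measurable_maxr => //; exact: measurable_minr.
  exists `|B| => x; rewrite /g' ler_norml ge_max le_max.
  have BB : B <= `|B| := ler_norm B.
  have NB : - B <= `|B| by rewrite -normrN ler_norm.
  by rewrite lerN2 BB NB/= ge_min BB.
- split => //; apply: measure_negligible; first exact: measurableC.
  exact: hB.
- move=> x /=; rewrite ler_norml => /andP[h1 h2].
  by rewrite /g' (min_idPr h2) (max_idPr h1).
Qed.

End Linfty.

(** * Supports and the scalar product cost *)

Section support.
Context {R : realType} {n : nat}.

Definition rat_cube (p : 'rV[rat]_n * rat) : set 'rV[R]_n :=
  [set v | forall j, `|v 0 j - ratr (p.1 0 j)| < ratr p.2].

Lemma open_rat_cube (U : set 'rV[R]_n) x : open U -> U x ->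
  exists2 p, rat_cube p x & rat_cube p `<=` U.
Proof.
move=> oU Ux.
have /nbhs_ballP[e /= e0 eU] : nbhs x U by exact: open_nbhs_nbhs.
have [q] := rat_in_itvoo (divr_gt0 e0 (ltr0n R 2)); rewrite in_itv/= => /andP[q0 qe].
have /choice[a ha] : forall j : 'I_n, exists a : rat, `|x 0 j - ratr a| < ratr q.
  move=> j; have : x 0 j - ratr q < x 0 j + ratr q by rewrite ltrD2l gtrN.
  move=> /rat_in_itvoo[a]; rewrite in_itv/= => /andP[h1 h2]; exists a.
  by rewrite distrC ltr_distl h1 h2.
exists (\row_j a j, q); first by move=> j; rewrite mxE.
move=> v hv; apply: eU; split => // i j; rewrite (ord1 i) /ball/=.
have := hv j; rewrite mxE => hvj; have := ha j => haj.
rewrite (splitr e) -(subrKA (ratr (a j))).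
rewrite (le_lt_trans (ler_normD _ _))// ltrD ?(lt_trans haj)//.
by rewrite distrC (lt_trans hvj).
Qed.

Lemma measurable_rat_cube p : measurable (rat_cube p).
Proof.
have -> : rat_cube p = \bigcap_(j in [set: 'I_n]) ((fun v : 'rV[R]_n => v 0 j) @^-1`
    `](ratr (p.1 0 j) - ratr p.2), (ratr (p.1 0 j) + ratr p.2)[).
  apply/seteqP; split=> v /= h j => [_|].
    by rewrite /= in_itv/= -ltr_distl; exact: h.
  by have := h j I; rewrite /= in_itv/= -ltr_distl.
apply: fin_bigcap_measurable => // j _; rewrite -[X in measurable X]setTI.
exact: measurable_coord_rV.
Qed.

Lemma closed_msupport (P : {measure set 'rV[R]_n -> \bar R}) : closed (msupport P).
Proof.
rewrite -[msupport P]setCK; apply: open_closedC; rewrite openE => x /existsNP[U].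
move=> /not_implyP[oU /not_implyP[Ux PU]].
apply: (filterS _ (open_nbhs_nbhs (conj oU Ux))) => y Uy /(_ U oU Uy).
exact: PU.
Qed.

Lemma measurable_msupport (P : {measure set 'rV[R]_n -> \bar R}) :
  measurable (msupport P).
Proof.
rewrite -[msupport P]setCK; apply: measurableC; apply: open_measurable_rV.
by apply: closed_openC; exact: closed_msupport.
Qed.

(* Lindelof: the complement of the support is a countable union of null cubes. *)
Lemma full_msupport (P : {measure set 'rV[R]_n -> \bar R}) : full P (msupport P).
Proof.
split; first exact: measurable_msupport.
apply: measure_negligible; first by apply: measurableC; exact: measurable_msupport.
(* An enumeration of the null rational cubes; the other indices contribute the empty set. *)
pose F k : set 'rV[R]_n := if unpickle k is Some p then
  (if P (rat_cube p) == 0%E then rat_cube p else set0) else set0.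
apply: (@negligibleS _ _ _ _ (\bigcup_k F k)).
  move=> x /existsNP[U] /not_implyP[oU /not_implyP[Ux PU]].
  have [p px pU] := open_rat_cube oU Ux.
  exists (pickle p) => //; rewrite /F pickleK.
  suff -> : P (rat_cube p) == 0%E by [].
  rewrite -measure_le0; apply: (@le_trans _ _ (P U)).
    apply: le_measure => //; rewrite inE; first exact: measurable_rat_cube.
    exact: open_measurable_rV.
  by rewrite leNgt; apply/negP.
apply: negligible_bigcup => k; rewrite /F; case: unpickle => [p|]; last exact: negligible_set0.
case: ifPn => [/eqP p0|_]; last exact: negligible_set0.
by exists (rat_cube p); split => //; exact: measurable_rat_cube.
Qed.

Lemma compact_coord_bounded (X : set 'rV[R]_n) : compact X ->
  exists r, forall x, X x -> forall i, `|x 0 i| <= r.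
Proof.
move=> cX.
have /choice[r hr] : forall i : 'I_n, exists r, forall x, X x -> `|x 0 i| <= r.
  move=> i.
  have ci : compact ((fun x : 'rV[R]_n => x 0 i) @` X).
    apply: continuous_compact => //; apply: continuous_subspaceT => x.
    exact: coord_continuous.
  have [M [_ hM]] := compact_bounded ci.
  exists (M + 1) => x Xx; apply: (hM (M + 1)); first by rewrite ltrDl.
  by exists x.
exists (\sum_i `|r i|) => x Xx i; rewrite (bigD1 i)//=.
rewrite (le_trans (hr i x Xx))// (le_trans (ler_norm _))// lerDl.
exact: sumr_ge0.
Qed.

Lemma measurable_dotrV :
  measurable_fun setT (fun p : 'rV[R]_n * 'rV[R]_n => dotrV p.1 p.2).
Proof.
apply: measurable_sum => i; apply: measurable_funM.
  exact: (measurableT_comp (measurable_coord_rV i) measurable_fst).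
exact: (measurableT_comp (measurable_coord_rV i) measurable_snd).
Qed.

Lemma dotrV_bounded (X Y : set 'rV[R]_n) r s :
  (forall x, X x -> forall i, `|x 0 i| <= r) ->
  (forall y, Y y -> forall i, `|y 0 i| <= s) ->
  forall x y, X x -> Y y -> `|dotrV x y| <= \sum_(i < n) r * s.
Proof.
move=> Xr Ys x y Xx Yy; rewrite (le_trans (ler_norm_sum _ _ _))//.
by apply: ler_sum => i _; rewrite normrM ler_pM// ?Xr ?Ys.
Qed.

Lemma dotrV_mid (x x' y : 'rV[R]_n) :
  dotrV (2^-1 *: (x + x')) y = (dotrV x y + dotrV x' y) / 2.
Proof.
rewrite /dotrV -big_split/= mulr_suml; apply: eq_bigr => i _.
by rewrite !mxE; lra.
Qed.

End support.

Lemma convex_midpoint {R : realType} n (X : set 'rV[R]_n) x x' :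
  convex_set (X : set (convex_lmodType 'rV[R]_n)) -> X x -> X x' ->
  X (2^-1 *: (x + x')).
Proof.
move=> cX Xx Xx'.
have h0 : 0 <= 2^-1 :> R by rewrite invr_ge0.
have h1 : 2^-1 <= 1 :> R by rewrite invf_le1// ler1n.
have := cX x x' (Itv01 h0 h1) (mem_set Xx) (mem_set Xx').
rewrite /conv /= inE scalerDr.
by rewrite (_ : unstable.onem 2^-1 = 2^-1 :> R)// /unstable.onem {1}(splitr 1) div1r addrK.
Qed.

(** * The contraction for the gap of Sinkhorn's iterates *)

Section entropic_dual_bound.
Context {R : realType} {d1 d2} {T1 : measurableType d1} {T2 : measurableType d2}.
Variables (mu : probability T1 R) (nu : probability T2 R).
Variables (c : T1 -> T2 -> R) (lambda : R).
Hypothesis bc : bmeas (fun p : T1 * T2 => c p.1 p.2).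
Hypothesis lambda_gt0 : 0 < lambda.

(** Boundedness above makes [dual_sup] a genuine supremum rather than the default value of [sup].
    Integrating exp(u) >= 1 + u over a section of unit mass bounds the transform by C minus the
    integral of [psi]. *)
Lemma dual_le_bound C phi psi : (forall x y, c x y <= C) -> bmeas phi -> bmeas psi ->
  dual mu nu c lambda phi psi <= C.
Proof.
move=> cC bphi bpsi; apply: le_trans (dual_le_semidual mu nu bc lambda_gt0 bphi bpsi) _.
have bl := bmeas_trl mu nu bc lambda_gt0 bpsi.
rewrite /semidual -lerBrDr.
have h : forall x, transform_r nu c lambda psi x <= C - \int[nu]_y psi y.
  move=> x; have g := bmeas_gibbs_section lambda bc (transform_r nu c lambda psi x) x bpsi.
  have bcx := bmeas_cost bc x.
  have m := trf_mass nu bc lambda_gt0 x bpsi.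
  move: (transform_r _ _ _ _ _) g m => r g m.
  have bz : bmeas (fun y => (r + psi y - c x y) / lambda) by bm.
  have : \int[nu]_y (1 + (r + psi y - c x y) / lambda) <= 1.
    by rewrite -[leRHS]m; apply: le_int => [||y]; [by bm|by []|exact: expR_ge1Dx].
  rewrite intD; [|by bm|by []]; rewrite int_cst.
  have -> : \int[nu]_y ((r + psi y - c x y) / lambda) =
      lambda^-1 * \int[nu]_y (r + psi y - c x y).
    by rewrite -intZ; [apply: eq_int => y; rewrite mulrC|bm].
  rewrite gerDl pmulr_rle0 ?invr_gt0// intB; [|by bm|by []].
  rewrite intD; [|by bm|by []]; rewrite int_cst.
  have : \int[nu]_y c x y <= C.
    by rewrite -[leRHS](int_cst nu C); apply: le_int => [||y]; [by []|by bm|exact: cC].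
  lra.
by rewrite -[leRHS](int_cst mu); apply: le_int => [||x]; [by []|by bm|exact: h].
Qed.

End entropic_dual_bound.

Section gap_contraction.
Context {R : realType} {d1 d2} {T1 : measurableType d1} {T2 : measurableType d2}.
Variables (mu : probability T1 R) (nu : probability T2 R).
Variables (X : set T1) (Y : set T2).
Variables (c c' : T1 -> T2 -> R) (lambda K rho : R) (psi0 : T2 -> R).
Hypothesis fX : full mu X.
Hypothesis fY : full nu Y.
Hypothesis mc : measurable_fun setT (fun p : T1 * T2 => c p.1 p.2).
Hypothesis bc' : bmeas (fun p : T1 * T2 => c' p.1 p.2).
Hypothesis cc' : forall x y, X x -> Y y -> c x y = c' x y.
Hypothesis lambda_gt0 : 0 < lambda.
Hypothesis K_ge0 : 0 <= K.
Hypothesis rho_ge1 : 1 <= rho.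
Hypothesis c_osc : forall x x' y y', c' x y - c' x' y' <= K.
Hypothesis trl_variance : forall psi0 psi1, bmeas psi0 -> bmeas psi1 ->
  (forall y y', psi0 y - psi0 y' <= K) -> (forall y y', psi1 y - psi1 y' <= K) ->
  exists k,
  \int[mu]_x (transform_r nu c' lambda psi1 x - transform_r nu c' lambda psi0 x - k) ^+ 2 <=
  38 * rho * K * \int[mu]_x (transform_r nu c' lambda (fun y => (psi0 y + psi1 y) / 2) x -
    (transform_r nu c' lambda psi0 x + transform_r nu c' lambda psi1 x) / 2).
Hypothesis psi0_Linfty : psi0 \in Lfun nu +oo%E.

Local Notation S := (dual_sup mu nu c lambda).
Local Notation E := (semidual mu nu c' lambda).
Local Notation delta := (dual_gap mu nu c lambda psi0).

Let mc' := bc'.1.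

Lemma dual_bmeas_eq phi psi : bmeas phi -> bmeas psi ->
  dual mu nu c lambda phi psi = dual mu nu c' lambda phi psi.
Proof.
by move=> [mphi _] [mpsi _]; exact: (dual_eq_full lambda fX fY mc mc' cc' fX fY).
Qed.

Lemma dual_Linfty_eq phi psi : phi \in Lfun mu +oo%E -> psi \in Lfun nu +oo%E ->
  exists phi' psi', [/\ bmeas phi', bmeas psi' &
    dual mu nu c lambda phi psi = dual mu nu c' lambda phi' psi'].
Proof.
move=> /Linfty_truncation[mphi [phi' [A [bphi fA hA]]]].
move=> /Linfty_truncation[mpsi [psi' [B [bpsi fB hB]]]].
exists phi', psi'; split; [exact: bphi|exact: bpsi|].
exact: (dual_eq_full lambda fX fY mc mc' cc' fA fB mphi bphi.1 mpsi bpsi.1 hA hB).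
Qed.

Let duals := [set dual mu nu c lambda p.1 p.2 | p in
  [set p : (T1 -> R) * (T2 -> R) |
    p.1 \in Lfun mu +oo%E /\ p.2 \in Lfun nu +oo%E]].

Let duals_mem phi psi : bmeas phi -> bmeas psi -> duals (dual mu nu c' lambda phi psi).
Proof.
move=> bphi bpsi; exists (phi, psi); last exact: dual_bmeas_eq.
by split; exact: bmeas_Linfty.
Qed.

Let duals_has_sup : has_sup duals.
Proof.
split.
  by exists (dual mu nu c' lambda (fun=> 0) (fun=> 0)); apply: duals_mem; exact: bmeas_cst.
have [_ [C hC]] := bc'; exists C => _ [[phi psi] /= [Lphi Lpsi] <-].
have [phi' [psi' [bphi bpsi ->]]] := dual_Linfty_eq Lphi Lpsi.
apply: dual_le_bound => // x y; exact: le_trans (ler_norm _) (hC (x, y)).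
Qed.

Lemma semidual_le_dual_sup psi : bmeas psi -> E psi <= S.
Proof.
move=> bpsi; rewrite -(dual_trl mu nu bc' lambda_gt0 bpsi).
apply: sup_upper_bound; first exact: duals_has_sup.
by apply: duals_mem => //; exact: bmeas_trl.
Qed.

(** A nearly optimal pair stays so when its first component is replaced by the transform of the
    second. *)
Lemma dual_sup_approx e : 0 < e -> exists2 psi, bmeas psi & S - e <= E psi.
Proof.
move=> e0; have [_ [[phi psi] /= [Lphi Lpsi] <-]] := sup_adherent e0 duals_has_sup.
have [phi' [psi' [bphi bpsi ->]]] := dual_Linfty_eq Lphi Lpsi.
move=> /ltW h; exists psi' => //; apply: le_trans h _.
exact: dual_le_semidual.
Qed.

(** The essentially bounded start is clipped and the cost replaced by [c']; both change the iterates
    only on null sets and leave the gap as it is. *)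
Lemma dual_gap_semidual : exists2 psi0', bmeas psi0' & forall t,
  bmeas (sinkhorn_psi mu nu c' lambda psi0' t) /\
  delta t = S - E (sinkhorn_psi mu nu c' lambda psi0' t).
Proof.
have [m0 [psi0' [A [b0 fA hA]]]] := Linfty_truncation psi0_Linfty.
exists psi0' => // t.
have bt : bmeas (sinkhorn_psi mu nu c' lambda psi0' t).
  by elim: t => [//|t IH]; exact: (bmeas_sink mu nu bc' lambda_gt0 IH).
split => //; rewrite /dual_gap.
rewrite (dual_sinkhorn_eq_full lambda fX fY mc mc' cc' t fA m0 b0.1 hA).
by rewrite -(dual_trl mu nu bc' lambda_gt0 bt).
Qed.

Lemma dual_gap_contraction alpha t : 33 + 176 * (rho * K / lambda) <= alpha ->
  delta t.+1 <= delta t * (1 - alpha^-1).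
Proof.
move=> ha; have [psi0' _ h] := dual_gap_semidual.
have [bt ->] := h t; have [_ ->] := h t.+1.
exact: (semidual_sink_contraction bc' lambda_gt0 K_ge0 rho_ge1 c_osc
  semidual_le_dual_sup dual_sup_approx trl_variance bt ha).
Qed.

Lemma dual_gap_geometric alpha t : 33 + 176 * (rho * K / lambda) <= alpha ->
  delta t <= delta 0%N * (1 - alpha^-1) ^+ t.
Proof.
(* The induction multiplies by this factor; its sign comes from alpha >= 33. *)
move=> ha; have a1 : 0 <= 1 - alpha^-1.
  have a0 : 0 <= rho * K / lambda.
    rewrite divr_ge0//; last exact: ltW.
    by rewrite mulr_ge0//; exact: le_trans ler01 rho_ge1.
  rewrite subr_ge0 invf_le1; lra.
elim: t => [|t IH]; first by rewrite expr0 mulr1.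
apply: le_trans (dual_gap_contraction t ha) _.
move: (delta 0%N) (delta t) IH => D0 D IH.
by rewrite exprSr mulrA; exact: ler_wpM2r.
Qed.

End gap_contraction.

(** * The bounded extension of the cost and the conclusion *)

Lemma full_nonempty {R : realType} d (T : measurableType d) (P : probability T R) A :
  full P A -> A !=set0.
Proof.
move=> [_ A0]; apply/set0P/eqP => AE; move: A0; rewrite AE setC0.
have -> : (P : {measure set T -> \bar R}) setT = 1%E by exact: probability_setT.
by move/eqP; rewrite onee_eq0.
Qed.

Section truncated_cost.
Context {R : realType} {T1 T2 : Type} (X : set T1) (Y : set T2).
Variables (c : T1 -> T2 -> R) (B : R).
Hypothesis c_bounded : forall x y, X x -> Y y -> `|c x y| <= B.
Hypothesis X0 : X !=set0.
Hypothesis Y0 : Y !=set0.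

Let values := [set c p.1 p.2 | p in X `*` Y].

(* The extension of [c] by a constant off [X `*` Y] is bounded on the whole space
   with the same oscillation, and it changes the transforms, hence the dual
   functional, only on null sets. *)
Definition truncated_cost x y : R := if (x, y) \in X `*` Y then c x y else inf values.

Lemma truncated_cost_eq x y : X x -> Y y -> c x y = truncated_cost x y.
Proof. by move=> Xx Yy; rewrite /truncated_cost mem_set. Qed.

Let values0 : values !=set0.
Proof. by have [x Xx] := X0; have [y Yy] := Y0; exists (c x y), (x, y). Qed.

Let values_ub : has_ubound values.
Proof. by exists B => _ [[x y] [Xx Yy] <-]; exact: le_trans (ler_norm _) (c_bounded Xx Yy). Qed.

Let values_lb : has_lbound values.
Proof. by exists (- B) => _ [[x y] [Xx Yy] <-]; have := c_bounded Xx Yy; rewrite ler_norml => /andP[]. Qed.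

Lemma truncated_cost_itv x y : inf values <= truncated_cost x y <= sup values.
Proof.
have h p : values p -> inf values <= p <= sup values.
  by move=> vp; rewrite ge_inf// ub_le_sup.
rewrite /truncated_cost; case: ifPn => [|_].
  by rewrite inE => -[Xx Yy]; apply: h; exists (x, y).
by rewrite lexx; have [p /h/andP[]] := values0; exact: le_trans.
Qed.

Lemma truncated_cost_osc x x' y y' :
  truncated_cost x y - truncated_cost x' y' <= oscillation X Y c.
Proof.
have /andP[_ h1] := truncated_cost_itv x y.
have /andP[h2 _] := truncated_cost_itv x' y'.
exact: lerB.
Qed.

Lemma oscillation_ge0 : 0 <= oscillation X Y c.
Proof.
have [x _] := X0; have [y _] := Y0.
by have := truncated_cost_osc x x y y; rewrite subrr.
Qed.

End truncated_cost.

Lemma bmeas_truncated_cost {R : realType} d1 d2 (T1 : measurableType d1)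
    (T2 : measurableType d2) (X : set T1) (Y : set T2) (c : T1 -> T2 -> R) B :
  measurable X -> measurable Y -> X !=set0 -> Y !=set0 ->
  (forall x y, X x -> Y y -> `|c x y| <= B) ->
  measurable_fun setT (fun p : T1 * T2 => c p.1 p.2) ->
  bmeas (fun p : T1 * T2 => truncated_cost X Y c p.1 p.2).
Proof.
move=> mX mY X0 Y0 cB mc; split; last first.
  pose a := inf [set c p.1 p.2 | p in X `*` Y].
  pose b := sup [set c p.1 p.2 | p in X `*` Y].
  exists (`|a| + `|b|) => -[x y].
  have /andP[h1 h2] := truncated_cost_itv cB X0 Y0 x y.
  have := ler_norm b; have := ler_norm (- a); rewrite normrN => na nb.
  have a0 := normr_ge0 a; have b0 := normr_ge0 b.
  rewrite ler_norml; apply/andP; split => /=; [rewrite -/a in h1|rewrite -/b in h2]; lra.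
have -> : (fun p : T1 * T2 => truncated_cost X Y c p.1 p.2) =
    (fun p => if p \in X `*` Y then c p.1 p.2 else inf [set c p.1 p.2 | p in X `*` Y]).
  by apply/funext => -[x y].
apply: measurable_fun_ifT => //.
apply: (@measurable_fun_bool _ _ _ _ true).
rewrite setTI (_ : _ @^-1` _ = X `*` Y); first exact: measurableX.
by apply/seteqP; split => p; [exact: set_mem|exact: mem_set].
Qed.

Theorem theorem1p2 (R : realType) (d : nat) (X Y : set 'rV[R]_d)
    (mu nu : probability 'rV[R]_d R) (f : 'rV[R]_d -> R)
    (lambda m M : R) (psi0 : 'rV[R]_d -> R)
    (compactX : compact X) (compactY : compact Y)
    (convexX : convex_set (X : set (convex_lmodType 'rV[R]_d)))
    (supp_mu : msupport mu = X) (supp_nu : msupport nu = Y)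
    (lambda_gt0 : 0 < lambda)
    (f_density : is_density_on mu X f)
    (m_gt0 : 0 < m) (f_bounds : forall x, X x -> m <= f x <= M)
    (psi0_Linfty : psi0 \in Lfun nu +oo%E) :
  let c := fun x y : 'rV[R]_d => - dotrV x y in
  let c_infty := oscillation X Y c in
  let delta := dual_gap mu nu c lambda psi0 in
  (let alpha := 176 * (1 + M / m * (c_infty / lambda)
                         + c_infty ^+ 2 / lambda ^+ 2) in
   forall t : nat, delta t <= delta 0%N * (1 - alpha^-1) ^+ t) /\
  (let alpha := 176 * (1 + M / m * (c_infty / lambda)) in
   \forall t \near \oo, delta t.+1 <= delta t * (1 - alpha^-1)).
Proof.
move=> c K delta.
have fX : full mu X by rewrite -supp_mu; exact: full_msupport.
have fY : full nu Y by rewrite -supp_nu; exact: full_msupport.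
have X0 := full_nonempty fX; have Y0 := full_nonempty fY.
have [r Xr] := compact_coord_bounded compactX.
have [s Ys] := compact_coord_bounded compactY.
have cB x y : X x -> Y y -> `|c x y| <= \sum_(i < d) r * s.
  by move=> Xx Yy; rewrite normrN; exact: dotrV_bounded Xr Ys x y Xx Yy.
have mc : measurable_fun setT (fun p : 'rV[R]_d * 'rV[R]_d => c p.1 p.2).
  exact: measurableT_comp measurable_dotrV.
have bc' := bmeas_truncated_cost fX.1 fY.1 X0 Y0 cB mc.
have K0 : 0 <= K := oscillation_ge0 cB X0 Y0.
have rho1 : 1 <= M / m.
  have [x Xx] := X0; have /andP[h1 h2] := f_bounds x Xx.
  by rewrite ler_pdivlMr// mul1r (le_trans h1).
have c_mid x x' y : X x -> X x' -> X (2^-1 *: (x + x')) /\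
    truncated_cost X Y c (2^-1 *: (x + x')) y =
    (truncated_cost X Y c x y + truncated_cost X Y c x' y) / 2.
  move=> Xx Xx'; have Xm := convex_midpoint convexX Xx Xx'; split => //.
  (* For y in [Y] the cost is linear in x; off [Y] the extension takes a single value, which is its
     own average. *)
  have [Yy|NYy] := pselect (Y y).
    by rewrite -!truncated_cost_eq// /c dotrV_mid; lra.
  have h z : (z, y) \in X `*` Y = false by apply/negbTE/negP; rewrite inE => -[].
  by rewrite /truncated_cost !h; lra.
have [y0 _] := Y0.
have gap := dual_gap_contraction fX fY mc bc' (@truncated_cost_eq _ _ _ X Y c)
  lambda_gt0 K0 rho1 (truncated_cost_osc cB X0 Y0)
  (trl_variance_le nu y0 fX.1 f_density m_gt0 f_bounds Xr bc' lambda_gt0 K0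
    (truncated_cost_osc cB X0 Y0) c_mid) psi0_Linfty.
have geo := dual_gap_geometric fX fY mc bc' (@truncated_cost_eq _ _ _ X Y c)
  lambda_gt0 K0 rho1 (truncated_cost_osc cB X0 Y0)
  (trl_variance_le nu y0 fX.1 f_density m_gt0 f_bounds Xr bc' lambda_gt0 K0
    (truncated_cost_osc cB X0 Y0) c_mid) psi0_Linfty.
split=> [alpha t|alpha].
  (* With rho = M / m and K = c_oo, both constants alpha exceed the threshold 33 + 176 rho K /
     lambda. *)
  apply: geo; rewrite /alpha -[M / m * K / lambda]mulrA.
  have : 0 <= K ^+ 2 / lambda ^+ 2 by rewrite -expr_div_n sqr_ge0.
  move: (M / m * _) (K ^+ 2 / _) => a b; lra.
apply: nearW => t; apply: gap; rewrite /alpha -[M / m * K / lambda]mulrA.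
by move: (M / m * _) => a; lra.
Qed.
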